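(* Let $L$ be a locally compact group with neutral element $e_L$, and let $f\in\mathcal P(\mathbb S^\infty,L)$. Then for each $u\in L$ the function $x\mapsto f(x,u)$ is infinitely differentiable on $]-1,1[$, and for each $n\in\mathbb N_0$, $$\lim_{d\to\infty}\varphi_{n,d}(u)=\frac{1}{n!}\frac{\partial^n f(0,u)}{\partial x^n}$$ uniformly for $u$ in compact subsets of $L$, where $\varphi_{n,d}$ are the $d$-Schoenberg functions of $f$. Moreover, for each $n\ge0$ the function $u\mapsto \frac{1}{n!}\frac{\partial^n f(0,u)}{\partial x^n}$ belongs to $\mathcal P(L)$, and these functions $\varphi_n(u):=\frac{1}{n!}\frac{\partial^n f(0,u)}{\partial x^n}$ satisfy $\sum_n\varphi_n(e_L)<\infty$ and $f(x,u)=\sum_{n=0}^\infty\varphi_n(u)x^n$, uniformly convergent on $[-1,1]\times L$.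
   Context: A kernel $k:X\times X\to\mathbb C$ on a set $X$ is positive definite if $\sum_{j,k=1}^n k(x_j,x_k)c_j\overline{c_k}\ge0$ for all $n$, $x_1,\dots,x_n\in X$, $c_1,\dots,c_n\in\mathbb C$. For a locally compact group $L$ (multiplicative, neutral element $e_L$), $\mathcal P(L)$ is the set of continuous $\varphi:L\to\mathbb C$ such that $(u,v)\mapsto\varphi(u^{-1}v)$ is a positive definite kernel on $L$. Let $\mathbb S^d=\{x\in\mathbb R^{d+1}:\|x\|=1\}$, $d\ge1$. $\mathcal P(\mathbb S^d,L)$ is the set of continuous $f:[-1,1]\times L\to\mathbb C$ such that $((\xi,u),(\eta,v))\mapsto f(\xi\cdot\eta,u^{-1}v)$ is a positive definite kernel on $\mathbb S^d\times L$, and $\mathcal P(\mathbb S^\infty,L)=\bigcap_{d\ge1}\mathcal P(\mathbb S^d,L)$. For $d\ge2$ let $c_n(d,x)=C_n^{(\lambda)}(x)/C_n^{(\lambda)}(1)$ with $\lambda=(d-1)/2$, $C_n^{(\lambda)}$ the Gegenbauer polynomials; $c_n(1,x)=T_n(x)$ (Chebyshev polynomials). Let $\sigma_d=2\pi^{(d+1)/2}/\Gamma((d+1)/2)$, $N_0(d)=1$, $N_n(d)=\frac{(d)_{n-1}}{n!}(d+2n-1)$ for $n\ge1$ ($(a)_k$ the Pochhammer symbol). For $f\in\mathcal P(\mathbb S^d,L)$ the $d$-Schoenberg functions are $\varphi_{n,d}(u)=\frac{N_n(d)\sigma_{d-1}}{\sigma_d}\int_{-1}^1 f(x,u)c_n(d,x)(1-x^2)^{d/2-1}\,dx$,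 $n\ge0$; they lie in $\mathcal P(L)$, $\sum_n\varphi_{n,d}(e_L)<\infty$ and $f(x,u)=\sum_n\varphi_{n,d}(u)c_n(d,x)$ uniformly. *)

(* Defs.v *)
From Stdlib Require Import Reals Lra List ClassicalEpsilon Arith Factorial.
Open Scope R_scope.

Record Cpx := mkC { Cre : R ; Cim : R }.
Definition C0 : Cpx := mkC 0 0.
Definition Cadd (z w : Cpx) : Cpx := mkC (Cre z + Cre w) (Cim z + Cim w).
Definition Cmul (z w : Cpx) : Cpx :=
  mkC (Cre z * Cre w - Cim z * Cim w) (Cre z * Cim w + Cim z * Cre w).
Definition Cconj (z : Cpx) : Cpx := mkC (Cre z) (- Cim z).
Definition Cscale (a : R) (z : Cpx) : Cpx := mkC (a * Cre z) (a * Cim z).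
Definition Csub (z w : Cpx) : Cpx := mkC (Cre z - Cre w) (Cim z - Cim w).
Definition Cnorm (z : Cpx) : R := sqrt (Cre z ^ 2 + Cim z ^ 2).
Definition RtoC (a : R) : Cpx := mkC a 0.

Fixpoint Csum (n : nat) (g : nat -> Cpx) : Cpx :=
  match n with O => C0 | S m => Cadd (Csum m g) (g m) end.

Definition Cnonneg (z : Cpx) : Prop := Cim z = 0 /\ 0 <= Cre z.

Definition pos_def_kernel (X : Type) (k : X -> X -> Cpx) : Prop :=
  forall (n : nat) (x : nat -> X) (c : nat -> Cpx),
    Cnonneg (Csum n (fun j => Csum n (fun l =>
       Cmul (Cmul (k (x j) (x l)) (c j)) (Cconj (c l))))).

Definition compact_for (T : Type) (opn : (T -> Prop) -> Prop) (K : T -> Prop) : Prop :=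
  forall (I : Type) (F : I -> T -> Prop),
    (forall i, opn (F i)) ->
    (forall x, K x -> exists i, F i x) ->
    exists l : list I, forall x, K x -> exists i, In i l /\ F i x.

Record LCGroup := {
  carrier :> Type;
  gmul : carrier -> carrier -> carrier;
  ginv : carrier -> carrier;
  gone : carrier;
  gmulA : forall x y z, gmul x (gmul y z) = gmul (gmul x y) z;
  gmul1l : forall x, gmul gone x = x;
  gmulVl : forall x, gmul (ginv x) x = gone;
  gopen : (carrier -> Prop) -> Prop;
  gopen_full : gopen (fun _ => True);
  gopen_inter : forall U V, gopen U -> gopen V -> gopen (fun x => U x /\ V x);
  gopen_union : forall (I : Type) (F : I -> carrier -> Prop),
      (forall i, gopen (F i)) -> gopen (fun x => exists i, F i x);
  ghausdorff : forall x y, x <> y ->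
      exists U V, gopen U /\ gopen V /\ U x /\ V y /\ (forall z, U z -> V z -> False);
  gmul_cont : forall x y W, gopen W -> W (gmul x y) ->
      exists U V, gopen U /\ gopen V /\ U x /\ V y /\
                  (forall a b, U a -> V b -> W (gmul a b));
  ginv_cont : forall x W, gopen W -> W (ginv x) ->
      exists U, gopen U /\ U x /\ (forall a, U a -> W (ginv a));
  glocally_compact : forall x, exists U K, gopen U /\ U x /\
      (forall y, U y -> K y) /\ compact_for carrier gopen K
}.

Arguments gmul {l}. Arguments ginv {l}. Arguments gone {l}.

Definition compactL (L : LCGroup) (K : L -> Prop) : Prop := compact_for L (gopen L) K.

Definition continuous_L (L : LCGroup) (phi : L -> Cpx) : Prop :=
  forall u eps, 0 < eps -> exists U, gopen L U /\ U u /\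
    forall v, U v -> Cnorm (Csub (phi v) (phi u)) < eps.

Definition in_PL (L : LCGroup) (phi : L -> Cpx) : Prop :=
  continuous_L L phi /\
  pos_def_kernel L (fun u v => phi (gmul (ginv u) v)).

(* points of R^(d+1) are represented by their coordinates 0..d *)
Definition dotp (d : nat) (xi eta : nat -> R) : R :=
  sum_f_R0 (fun i => xi i * eta i) d.
Definition on_sphere (d : nat) (xi : nat -> R) : Prop := dotp d xi xi = 1.

(* continuity of f on [-1,1] x L (f is only relevant on [-1,1] x L) *)
Definition continuous_IL (L : LCGroup) (f : R -> L -> Cpx) : Prop :=
  forall x u eps, -1 <= x <= 1 -> 0 < eps ->
    exists delta U, 0 < delta /\ gopen L U /\ U u /\
      forall y v, -1 <= y <= 1 -> Rabs (y - x) < delta -> U v ->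
        Cnorm (Csub (f y v) (f x u)) < eps.

Definition in_P_S (L : LCGroup) (d : nat) (f : R -> L -> Cpx) : Prop :=
  continuous_IL L f /\
  pos_def_kernel ({xi : nat -> R | on_sphere d xi} * L)
    (fun p q => f (dotp d (proj1_sig (fst p)) (proj1_sig (fst q)))
                  (gmul (ginv (snd p)) (snd q))).

Definition in_P_Sinf (L : LCGroup) (f : R -> L -> Cpx) : Prop :=
  forall d : nat, (1 <= d)%nat -> in_P_S L d f.

(* gamma_half k = Gamma(k/2) for k >= 1 *)
Fixpoint gamma_half (k : nat) : R :=
  match k with
  | O => 0
  | S O => sqrt PI
  | S (S O) => 1
  | S (S j) => (INR j / 2) * gamma_half j
  end.

(* sigma_d = 2 pi^((d+1)/2) / Gamma((d+1)/2) : surface area of S^d *)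
Definition sigma (d : nat) : R :=
  2 * Rpower PI (INR (d + 1) / 2) / gamma_half (d + 1).

Fixpoint poch (a : R) (k : nat) : R :=
  match k with O => 1 | S m => poch a m * (a + INR m) end.

Definition Ndim (n d : nat) : R :=
  match n with
  | O => 1
  | S m => poch (INR d) m / INR (fact n) * (INR d + 2 * INR n - 1)
  end.

(* Gegenbauer polynomials: (C_n^lam(x), C_(n+1)^lam(x)) via the three-term recurrence *)
Fixpoint geg2 (lam x : R) (n : nat) : R * R :=
  match n with
  | O => (1, 2 * lam * x)
  | S m => let (a, b) := geg2 lam x m in
           (b, (2 * x * (INR m + 1 + lam) * b - (INR m + 1 + 2 * lam - 1) * a) / (INR m + 2))
  end.
Definition gegenbauer (lam : R) (n : nat) (x : R) : R := fst (geg2 lam x n).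

(* Chebyshev polynomials of the first kind: (T_n(x), T_(n+1)(x)) *)
Fixpoint cheb2 (x : R) (n : nat) : R * R :=
  match n with
  | O => (1, x)
  | S m => let (a, b) := cheb2 x m in (b, 2 * x * b - a)
  end.
Definition chebyshev (n : nat) (x : R) : R := fst (cheb2 x n).

Definition cn (d n : nat) (x : R) : R :=
  match d with
  | O => 0
  | S O => chebyshev n x
  | _ => let lam := (INR d - 1) / 2 in gegenbauer lam n x / gegenbauer lam n 1
  end.

(* the weight (1 - x^2)^(d/2 - 1), written for d >= 2 as sqrt(1-x^2)^(d-2) *)
Definition weight (d : nat) (x : R) : R := sqrt (1 - x ^ 2) ^ (d - 2).

(* Riemann integral (total version: 0 when not Riemann integrable)     *)
Definition RInt (g : R -> R) (a b : R) : R :=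
  match excluded_middle_informative (exists _ : Riemann_integrable g a b, True) with
  | left H => RiemannInt (proj1_sig (constructive_indefinite_description _ H))
  | right _ => 0
  end.

Definition CRInt (g : R -> Cpx) (a b : R) : Cpx :=
  mkC (RInt (fun x => Cre (g x)) a b) (RInt (fun x => Cim (g x)) a b).

(* d-Schoenberg functions (used for d >= 2, where the integral is a proper Riemann integral) *)
Definition schoenberg (L : LCGroup) (f : R -> L -> Cpx) (d n : nat) (u : L) : Cpx :=
  Cscale (Ndim n d * sigma (d - 1) / sigma d)
    (CRInt (fun x => Cscale (cn d n x * weight d x) (f x u)) (-1) 1).

Definition derivs_on_open (g : R -> Cpx) (Dg : nat -> R -> Cpx) : Prop :=
  (forall x, -1 < x < 1 -> Dg O x = g x) /\
  (forall n x, -1 < x < 1 ->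
     derivable_pt_lim (fun y => Cre (Dg n y)) x (Cre (Dg (S n) x)) /\
     derivable_pt_lim (fun y => Cim (Dg n y)) x (Cim (Dg (S n) x))).

Definition Cseries_converges (a : nat -> Cpx) : Prop :=
  (exists l, infinite_sum (fun n => Cre (a n)) l) /\
  (exists l, infinite_sum (fun n => Cim (a n)) l).

(* Main.v *)
(** The Bernstein polynomials of [x |-> f(x,u)] on [[-1,1]] are the means of
    [f((e_1 + ... + e_N)/N, u)] over independent signs [e_i] with mean [x].  Expanded in powers
    of [x], their coefficients are, up to a positive factor, the Fourier coefficients of
    [z |-> f((z_1 + ... + z_N)/N, u)] on the cube [{-1,1}^N]; since the cube, rescaled by
    [1/sqrt N], lies on a sphere and [z.z'] is a sum over the product of two sign vectors, these
    coefficients are positive definite functions of [u].  Their absolute values therefore sum to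
    at most [f(1,e)], uniformly in [N] and [u], so they converge as [N -> oo] to positive definite
    functions [phi_k] with [f(x,u) = sum_k phi_k(u) x^k], uniformly on [[-1,1] x L].

    Inserting this expansion in the integral defining [phi_{n,d}] gives
    [phi_{n,d}(u) = sum_k A_k(n,d) phi_k(u)], where [A_k(n,d)] is [N_n(d)] times the mean of
    [x^k c_n(d,x)] on the sphere.  The three-term recurrence of the Gegenbauer polynomials yields
    [A_k(n,d)] in closed form, and [A_k(n,d) -> delta_kn] as [d -> oo], uniformly in [k]. *)

From Stdlib Require Import Reals Lra Lia Arith Factorial FunctionalExtensionality.
From Coquelicot Require Import Coquelicot.
Require Import Defs.
Open Scope R_scope.

(** * Moments of the weight *)

(** No compactness or subsequence argument enters the limit [N -> oo]. If the absolute coefficients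
    of a polynomial sum to at most [M], its tail after degree [m+1] is at most [M |x|^(m+2)]. At one
    fixed small [x], the value of the polynomial and its coefficients of index at most [m] therefore
    determine coefficient [m+1] up to [M x]. This single device, used by induction on the index,
    gives both the existence of the limit coefficients and their continuity in [u]. The remainder
    bound says nothing at [|x| = 1]. Uniformity up to the endpoints comes from the tail of
    [sum phi_k(e)], a majorant independent of [u], together with the continuity of [f]. Because the
    absolute values of the components of [phi_k(u)] sum to at most [f(1,e)], it is enough to bound
    [|A_k(n,d) - delta_kn|] by one quantity valid for all [k]. The consecutive nonzero moments
    [A_{n+2m}] have ratio at most 1 once [(n+1)(n+2) <= 2d], so the first off-diagonal one, of order
    [1/d], dominates all the others. Orthogonality to lower powers is not quoted; it falls out of
    the same recurrence. *)

Ltac eqR := match goal with |- ?a = ?b => change (@eq R a b) end.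

(** Link between the total integral of the statement and the Coquelicot one: integrability rules out
    the default value 0, and the value does not depend on the chosen witness. *)
Lemma RInt_of_is_RInt (g : R -> R) (a b v : R) : is_RInt g a b v -> RInt g a b = v.
Proof.
  intro H. unfold RInt.
  destruct (ClassicalEpsilon.excluded_middle_informative _) as [E | E].
  - rewrite <- RInt_Reals. now apply is_RInt_unique.
  - exfalso. apply E.
    assert (Hex : ex_RInt g a b) by now exists v.
    now exists (ex_RInt_Reals_0 _ _ _ Hex).
Qed.

(** The derivative formulas used below are checked only inside the interval, where the argument of
    the square root is positive; continuity takes care of the endpoints. The mean value theorem is
    applied to the difference of the two antiderivatives. *)
Lemma is_RInt_derive_open (F h : R -> R) (a b : R) :
  a < b ->
  (forall x, a < x < b -> is_derive F x (h x)) ->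
  (forall x, a <= x <= b -> continuous F x) ->
  (forall x, continuous h x) ->
  is_RInt h a b (F b - F a).
Proof.
  intros Hab HF HcF Hh.
  assert (Hex : forall y, ex_RInt h a y).
  { intro y. apply (ex_RInt_continuous (V := R_CompleteNormedModule)). intros; apply Hh. }
  assert (HI : forall x, is_derive (fun y => RInt.RInt h a y) x (h x)).
  { intro x. apply (is_derive_RInt (V := R_NormedModule) h (fun y => RInt.RInt h a y) a x); [|apply Hh].
    exists (mkposreal 1 Rlt_0_1). intros y _. apply (RInt_correct (V := R_CompleteNormedModule)), Hex. }
  destruct (MVT_gen (fun x => RInt.RInt h a x - F x) a b (fun _ => 0)) as [c [_ Hc]].
  - intros x Hx. rewrite Rmin_left, Rmax_right in Hx by lra.
    replace 0 with (h x - h x) by ring.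
    apply (is_derive_minus (V := R_NormedModule)); [apply HI | now apply HF].
  - intros x Hx. rewrite Rmin_left, Rmax_right in Hx by lra.
    apply continuity_pt_filterlim.
    apply (continuous_minus (V := R_NormedModule)); [|now apply HcF].
    apply (ex_derive_continuous (V := R_NormedModule)). eexists; apply HI.
  - rewrite (RInt_point a h) in Hc. unfold zero in Hc; simpl in Hc.
    replace (F b - F a) with (RInt.RInt h a b) by lra.
    apply (RInt_correct (V := R_CompleteNormedModule)), Hex.
Qed.

Lemma continuous_pow (k : nat) (x : R) : continuous (fun y : R => y ^ k) x.
Proof. apply (ex_derive_continuous (V := R_NormedModule)). auto_derive. trivial. Qed.

Lemma continuous_Rmult (g h : R -> R) (x : R) :
  continuous g x -> continuous h x -> continuous (fun y => g y * h y) x.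
Proof. intros; now apply (continuous_mult (K := R_AbsRing)). Qed.

Lemma continuous_Rplus (g h : R -> R) (x : R) :
  continuous g x -> continuous h x -> continuous (fun y => g y + h y) x.
Proof. intros; now apply (continuous_plus (V := R_NormedModule)). Qed.

Lemma continuous_sqrt_pow (j : nat) (x : R) : continuous (fun y => sqrt (1 - y ^ 2) ^ j) x.
Proof.
  apply (continuous_comp (fun y => sqrt (1 - y ^ 2)) (fun z => z ^ j)); [|apply continuous_pow].
  apply (continuous_comp (fun y => 1 - y ^ 2) sqrt); [|apply continuous_sqrt].
  apply (ex_derive_continuous (V := R_NormedModule)). auto_derive. trivial.
Qed.

Lemma continuous_weight (d : nat) (x : R) : continuous (weight d) x.
Proof. apply continuous_sqrt_pow. Qed.

(** For [d >= 2], the mean over [S^d] of [xi |-> p(xi . e)], with [e] a fixed unit vector. *)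
Definition sphere_mean (d : nat) (p : R -> R) : R :=
  sigma (d - 1) / sigma d * RInt.RInt (fun x => p x * weight d x) (-1) 1.

Lemma ex_RInt_weight (d : nat) (p : R -> R) :
  (forall x, continuous p x) -> ex_RInt (fun x => p x * weight d x) (-1) 1.
Proof.
  intro Hp. apply (ex_RInt_continuous (V := R_CompleteNormedModule)). intros x _.
  apply continuous_Rmult; [apply Hp | apply continuous_weight].
Qed.

Lemma sphere_mean_ext (d : nat) (p q : R -> R) :
  (forall x, -1 < x < 1 -> p x = q x) -> sphere_mean d p = sphere_mean d q.
Proof.
  intro H. unfold sphere_mean. f_equal. apply RInt_ext. intros x.
  rewrite Rmin_left, Rmax_right by lra. intro Hx. now rewrite H.
Qed.

Lemma sphere_mean_plus (d : nat) (p q : R -> R) :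
  (forall x, continuous p x) -> (forall x, continuous q x) ->
  sphere_mean d (fun x => p x + q x) = sphere_mean d p + sphere_mean d q.
Proof.
  intros Hp Hq. unfold sphere_mean. rewrite <- Rmult_plus_distr_l. f_equal.
  etransitivity; [|apply (RInt_plus (V := R_CompleteNormedModule));
                    now apply ex_RInt_weight].
  apply RInt_ext. intros x _. unfold plus; simpl. ring.
Qed.

Lemma sphere_mean_scal (d : nat) (c : R) (p : R -> R) :
  (forall x, continuous p x) -> sphere_mean d (fun x => c * p x) = c * sphere_mean d p.
Proof.
  intros Hp. unfold sphere_mean.
  transitivity (sigma (d - 1) / sigma d * (c * RInt.RInt (fun x => p x * weight d x) (-1) 1)); [|ring].
  f_equal.
  etransitivity; [|apply (RInt_scal (V := R_CompleteNormedModule) _ (-1) 1 c);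
                    now apply ex_RInt_weight].
  apply RInt_ext. intros x _. unfold scal; simpl; unfold mult; simpl. ring.
Qed.

Lemma one_minus_sq_pos (x : R) : -1 < x < 1 -> 0 < 1 - x ^ 2.
Proof. intro Hx. replace (1 - x ^ 2) with ((1 - x) * (1 + x)) by ring. apply Rmult_lt_0_compat; lra. Qed.

Lemma one_minus_sq_nonneg (x : R) : -1 <= x <= 1 -> 0 <= 1 - x ^ 2.
Proof. intro Hx. replace (1 - x ^ 2) with ((1 - x) * (1 + x)) by ring. apply Rmult_le_pos; lra. Qed.

(** With [s = sqrt (1 - x ^ 2)], the factor [1/s] in the derivative [- x / s] of [s] is absorbed by
    the exponent, which is at least 2. *)
Lemma is_derive_sqrt_pow (j : nat) (x : R) :
  -1 < x < 1 ->
  is_derive (fun y => sqrt (1 - y ^ 2) ^ S (S j)) x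
    (- (INR j + 2) * x * sqrt (1 - x ^ 2) ^ j).
Proof.
  intro Hx.
  assert (H1 := one_minus_sq_pos x Hx).
  assert (H2 : 0 < sqrt (1 - x ^ 2)) by now apply sqrt_lt_R0.
  auto_derive.
  - replace (1 + - (x * (x * 1))) with (1 - x ^ 2) by ring. exact H1.
  - replace (1 + - (x * (x * 1))) with (1 - x ^ 2) by ring.
    replace (match j with 0%nat => 1 | S _ => INR j + 1 end) with (INR j + 1)
      by (destruct j; simpl; lra).
    set (s := sqrt (1 - x ^ 2)) in *. field. lra.
Qed.

Lemma weight_add2 (d : nat) (x : R) :
  (2 <= d)%nat -> -1 <= x <= 1 -> weight (d + 2) x = (1 - x ^ 2) * weight d x.
Proof.
  intros Hd Hx. unfold weight. replace (d + 2 - 2)%nat with (S (S (d - 2))) by lia.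
  rewrite <- (sqrt_sqrt (1 - x ^ 2)) at 2 by now apply one_minus_sq_nonneg. simpl. ring.
Qed.

Lemma is_RInt_weight_odd (d : nat) :
  (2 <= d)%nat -> is_RInt (fun x => x * weight d x) (-1) 1 0.
Proof.
  intro Hd. unfold weight.
  assert (Hd0 : 0 < INR (d - 2) + 2) by (pose proof (pos_INR (d - 2)); lra).
  set (F := fun x => - / (INR (d - 2) + 2) * sqrt (1 - x ^ 2) ^ S (S (d - 2))).
  replace 0 with (F 1 - F (-1)).
  - apply (is_RInt_derive_open F); [lra | | |].
    + intros x Hx. unfold F.
      replace (x * sqrt (1 - x ^ 2) ^ (d - 2)) with
        (- / (INR (d - 2) + 2) * (- (INR (d - 2) + 2) * x * sqrt (1 - x ^ 2) ^ (d - 2)))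
        by (field; lra).
      apply (is_derive_scal (fun y => sqrt (1 - y ^ 2) ^ S (S (d - 2)))).
      now apply is_derive_sqrt_pow.
    + intros x _. apply continuous_Rmult; [apply continuous_const | apply continuous_sqrt_pow].
    + intro x. apply continuous_Rmult; [apply continuous_id | apply continuous_sqrt_pow].
  - unfold F. replace (1 - 1 ^ 2) with 0 by ring. replace (1 - (-1) ^ 2) with 0 by ring.
    rewrite sqrt_0. simpl. ring.
Qed.

(* Integration of the derivative of [x^(k+1) (1 - x^2)^(d/2)]. *)
Lemma sphere_mean_pow_step (d k : nat) :
  (2 <= d)%nat ->
  (INR d + 1 + INR k) * sphere_mean d (fun x => x ^ (k + 2)) = (INR k + 1) * sphere_mean d (fun x => x ^ k).
Proof.
  intro Hd.
  set (h := fun x => (INR k + 1) * x ^ k - (INR d + 1 + INR k) * x ^ (k + 2)).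
  assert (H0 : sphere_mean d h = 0).
  { unfold sphere_mean. rewrite (is_RInt_unique (V := R_CompleteNormedModule) _ _ _ 0); [ring|].
    set (F := fun x => x ^ (k + 1) * sqrt (1 - x ^ 2) ^ S (S (d - 2))).
    replace 0 with (F 1 - F (-1)).
    - apply (is_RInt_derive_open F); [lra | | |].
      + intros x Hx. unfold F, h, weight.
        assert (Hs : sqrt (1 - x ^ 2) * sqrt (1 - x ^ 2) = 1 - x ^ 2) by (apply sqrt_sqrt, Rlt_le, one_minus_sq_pos, Hx).
        replace (((INR k + 1) * x ^ k - (INR d + 1 + INR k) * x ^ (k + 2)) *
                  sqrt (1 - x ^ 2) ^ (d - 2)) with
          (plus (mult ((INR k + 1) * x ^ k) (sqrt (1 - x ^ 2) ^ S (S (d - 2))))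
             (mult (x ^ (k + 1)) (- (INR (d - 2) + 2) * x * sqrt (1 - x ^ 2) ^ (d - 2)))).
        * apply (is_derive_mult (fun y => y ^ (k + 1))
                  (fun y => sqrt (1 - y ^ 2) ^ S (S (d - 2)))).
          -- auto_derive; [trivial|]. rewrite Nat.add_1_r. simpl Nat.pred. rewrite S_INR. ring.
          -- now apply is_derive_sqrt_pow.
          -- intros; apply Rmult_comm.
        * set (s := sqrt (1 - x ^ 2)) in *.
          change ((INR k + 1) * x ^ k * s ^ S (S (d - 2)) +
                  x ^ (k + 1) * (- (INR (d - 2) + 2) * x * s ^ (d - 2)) =
                  ((INR k + 1) * x ^ k - (INR d + 1 + INR k) * x ^ (k + 2)) * s ^ (d - 2)).
          replace (s ^ S (S (d - 2))) with ((1 - x ^ 2) * s ^ (d - 2)) by (rewrite <- Hs; simpl; ring).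
          rewrite minus_INR, !pow_add by lia. change (INR 2) with 2. ring.
      + intros x _. apply continuous_Rmult; [apply continuous_pow | apply continuous_sqrt_pow].
      + intro x. apply continuous_Rmult; [|apply continuous_weight].
        unfold h. apply (continuous_minus (V := R_NormedModule));
          (apply continuous_Rmult; [apply continuous_const | apply continuous_pow]).
    - unfold F. replace (1 - 1 ^ 2) with 0 by ring. replace (1 - (-1) ^ 2) with 0 by ring.
      rewrite sqrt_0. simpl. ring. }
  assert (H1 : sphere_mean d h = (INR k + 1) * sphere_mean d (fun x => x ^ k)
                         + - (INR d + 1 + INR k) * sphere_mean d (fun x => x ^ (k + 2))).
  { rewrite <- !sphere_mean_scal by apply continuous_pow.
    rewrite <- sphere_mean_plus by
        (intro x; apply continuous_Rmult; [apply continuous_const | apply continuous_pow]).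
    apply sphere_mean_ext. intros x _. unfold h. ring. }
  lra.
Qed.

Lemma gamma_half_step (j : nat) :
  (1 <= j)%nat -> gamma_half (j + 2) = INR j / 2 * gamma_half j.
Proof. intro Hj. replace (j + 2)%nat with (S (S j)) by lia. destruct j; [lia|reflexivity]. Qed.

Lemma gamma_half_pos (j : nat) : (1 <= j)%nat -> 0 < gamma_half j.
Proof.
  assert (H : forall i, 0 < gamma_half (S i) /\ 0 < gamma_half (S (S i))).
  { induction i as [|i [IH1 IH2]].
    - simpl. split; [apply sqrt_lt_R0, PI_RGT_0 | lra].
    - split; [exact IH2|].
      replace (S (S (S i))) with (S i + 2)%nat by lia.
      rewrite gamma_half_step by lia.
      apply Rmult_lt_0_compat; [|exact IH1].
      apply Rdiv_lt_0_compat; [apply lt_0_INR; lia | lra]. }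
  intro Hj. destruct j as [|j]; [lia | apply H].
Qed.

Lemma sigma_ratio (d : nat) :
  (2 <= d)%nat ->
  sigma (d - 1) / sigma d = gamma_half (d + 1) / (gamma_half d * sqrt PI).
Proof.
  intro Hd. unfold sigma. replace (d - 1 + 1)%nat with d by lia.
  replace (INR (d + 1) / 2) with (INR d / 2 + / 2) by (rewrite plus_INR; simpl; field).
  rewrite Rpower_plus, Rpower_sqrt by apply PI_RGT_0.
  assert (H1 := gamma_half_pos d ltac:(lia)). assert (H2 := gamma_half_pos (d + 1) ltac:(lia)).
  assert (H3 : 0 < sqrt PI) by apply sqrt_lt_R0, PI_RGT_0.
  assert (H4 : 0 < Rpower PI (INR d / 2)) by apply exp_pos.
  field. repeat split; lra.
Qed.

(** The normalising integral for [d = 3]. Under [x = sin t] the integrand becomes [cos t ^ 2], with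
    antiderivative [(t + sin t cos t) / 2]. *)
Lemma RInt_sqrt_circle : RInt.RInt (fun x => sqrt (1 - x ^ 2)) (-1) 1 = PI / 2.
Proof.
  assert (HP := PI_RGT_0).
  assert (Hc := RInt_comp (V := R_CompleteNormedModule) (fun x => sqrt (1 - x ^ 2)) sin cos
                 (- (PI / 2)) (PI / 2)).
  rewrite sin_neg, sin_PI2 in Hc. replace (- (1)) with (-1) in Hc by ring. rewrite <- Hc.
  - apply is_RInt_unique.
    replace (PI / 2) with
      ((PI / 2 + sin (PI / 2) * cos (PI / 2)) / 2
       - (- (PI / 2) + sin (- (PI / 2)) * cos (- (PI / 2))) / 2) at 3
      by (rewrite sin_neg, cos_neg, cos_PI2; field).
    apply (is_RInt_derive_open (fun t => (t + sin t * cos t) / 2)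
             (fun y => scal (cos y) (sqrt (1 - sin y ^ 2)))); [lra | | |].
    + intros x Hx. assert (Hcos : 0 < cos x) by (apply cos_gt_0; lra).
      unfold scal; simpl; unfold mult; simpl.
      assert (Hs := sin2_cos2 x). unfold Rsqr in Hs.
      replace (1 - sin x * (sin x * 1)) with (cos x * cos x) by lra.
      rewrite sqrt_square by lra.
      auto_derive; [trivial|]. nra.
    + intros x _. apply (ex_derive_continuous (V := R_NormedModule)). auto_derive. trivial.
    + intro x. apply continuous_Rmult.
      * apply continuous_cos.
      * apply (continuous_comp (fun y => 1 - sin y ^ 2) sqrt); [|apply continuous_sqrt].
        apply (ex_derive_continuous (V := R_NormedModule)). auto_derive. trivial.
  - intros x _. apply (continuous_comp (fun y => 1 - y ^ 2) sqrt); [|apply continuous_sqrt].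
    apply (ex_derive_continuous (V := R_NormedModule)). auto_derive. trivial.
  - intros x _. split; [apply is_derive_sin | apply continuous_cos].
Qed.

(** Induction on [d] in steps of two, like the recursion of [gamma_half], from the base cases 2 and
    3. Since [weight (d + 2)] is [(1 - x^2) * weight d], the mean of 1 for [d + 2] is [(d+1)/d]
    times the mean of [1 - x^2] for [d], and the mean of [x^2] is [1/(d+1)]. *)
Lemma sphere_mean_1 (d : nat) : (2 <= d)%nat -> sphere_mean d (fun x => x ^ 0) = 1.
Proof.
  assert (H : forall i, sphere_mean (i + 2) (fun x => x ^ 0) = 1 /\ sphere_mean (i + 3) (fun x => x ^ 0) = 1).
  { induction i as [|i [IH1 IH2]].
    - split; simpl Nat.add; unfold sphere_mean; rewrite sigma_ratio by lia.
      + rewrite (RInt_ext _ (fun _ => 1)) by (intros; unfold weight; simpl; ring).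
        rewrite RInt_const. unfold scal; simpl; unfold mult; simpl.
        assert (0 < sqrt PI) by apply sqrt_lt_R0, PI_RGT_0. field. lra.
      + rewrite (RInt_ext _ (fun x => sqrt (1 - x ^ 2))) by (intros; unfold weight; simpl; ring).
        rewrite RInt_sqrt_circle.
        assert (Hs : 0 < sqrt PI) by apply sqrt_lt_R0, PI_RGT_0. simpl.
        assert (Hss : sqrt PI * sqrt PI = PI) by (apply sqrt_sqrt, Rlt_le, PI_RGT_0).
        set (s := sqrt PI) in *. rewrite <- Hss. field. lra.
    - split; [replace (S i + 2)%nat with (i + 3)%nat by lia; exact IH2|].
      replace (S i + 3)%nat with (i + 2 + 2)%nat by lia.
      set (d' := (i + 2)%nat) in *.
      assert (Hd : (2 <= d')%nat) by (unfold d'; lia).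
      assert (Hd' : 2 <= INR d') by (apply (le_INR 2), Hd).
      assert (Hst := sphere_mean_pow_step d' 0 Hd). rewrite IH1 in Hst. simpl (INR 0) in Hst.
      assert (Hw : RInt.RInt (fun x => x ^ 0 * weight (d' + 2) x) (-1) 1 =
                   RInt.RInt (fun x => (x ^ 0 + -1 * x ^ 2) * weight d' x) (-1) 1).
      { apply RInt_ext. intros x. rewrite Rmin_left, Rmax_right by lra. intro Hx.
        rewrite weight_add2 by (lia || lra). eqR. ring. }
      unfold sphere_mean. rewrite Hw, sigma_ratio by lia.
      replace (d' + 2 + 1)%nat with (d' + 1 + 2)%nat by lia.
      rewrite !gamma_half_step by lia.
      assert (H1 := gamma_half_pos d' ltac:(lia)).
      assert (H2 := gamma_half_pos (d' + 1) ltac:(lia)).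
      assert (H3 : 0 < sqrt PI) by apply sqrt_lt_R0, PI_RGT_0.
      transitivity (INR (d' + 1) / INR d' * sphere_mean d' (fun x => x ^ 0 + -1 * x ^ 2)).
      + unfold sphere_mean. rewrite sigma_ratio by lia. field. repeat split; lra.
      + rewrite sphere_mean_plus, sphere_mean_scal, IH1 by
          (intro x; first [apply continuous_pow
              | apply continuous_Rmult; [apply continuous_const | apply continuous_pow]]).
        simpl Nat.add in Hst.
        replace (sphere_mean d' (fun x => x ^ 2)) with (/ (INR d' + 1))
          by (apply (Rmult_eq_reg_l (INR d' + 1)); [|lra]; rewrite Rinv_r by lra; lra).
        rewrite plus_INR. simpl (INR 1). field. lra. }
  intro Hd. destruct d as [|[|d]]; [lia | lia |].
  replace (S (S d)) with (d + 2)%nat by lia. apply H.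
Qed.

Lemma sphere_mean_odd (d m : nat) : (2 <= d)%nat -> sphere_mean d (fun x => x ^ (2 * m + 1)) = 0.
Proof.
  intro Hd. induction m as [|m IH].
  - unfold sphere_mean. rewrite (is_RInt_unique (V := R_CompleteNormedModule) _ _ _ 0); [ring|].
    apply (is_RInt_ext (fun x => x * weight d x)); [intros; simpl; ring|].
    now apply is_RInt_weight_odd.
  - assert (H := sphere_mean_pow_step d (2 * m + 1) Hd). rewrite IH in H.
    replace (2 * S m + 1)%nat with (2 * m + 1 + 2)%nat by lia.
    apply (Rmult_eq_reg_l (INR d + 1 + INR (2 * m + 1))); [lra|].
    pose proof (pos_INR d). pose proof (pos_INR (2 * m + 1)). lra.
Qed.

(** The product [(d+1)(d+3)...(d+2j-1)], that is [2^j] times the Pochhammer symbol of [(d+1)/2] of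
    order [j]. *)
Fixpoint odd_step_prod (d j : nat) : R :=
  match j with O => 1 | S i => odd_step_prod d i * (INR d + 1 + 2 * INR i) end.

Lemma dprod_pos (d j : nat) : 0 < odd_step_prod d j.
Proof.
  induction j as [|j IH]; simpl; [lra|].
  apply Rmult_lt_0_compat; [exact IH|]. pose proof (pos_INR d). pose proof (pos_INR j). lra.
Qed.

(** Closed form of the mean of [x^(n+2m) c_n(d,x)] on the sphere. For [n = 0] it is the even moment
    [1.3...(2m-1) / ((d+1)(d+3)...(d+2m-1))]. *)
Definition moment_value (d n m : nat) : R :=
  INR (fact (n + 2 * m)) / (2 ^ m * INR (fact m) * odd_step_prod d (n + m)).

Lemma fact_S_INR (n : nat) : INR (fact (S n)) = (INR n + 1) * INR (fact n).
Proof. rewrite fact_simpl, mult_INR, S_INR. ring. Qed.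

Lemma sphere_mean_even (d m : nat) :
  (2 <= d)%nat -> sphere_mean d (fun x => x ^ (2 * m)) = moment_value d 0 m.
Proof.
  intro Hd. induction m as [|m IH].
  - rewrite sphere_mean_1 by exact Hd. unfold moment_value. simpl. field.
  - assert (H := sphere_mean_pow_step d (2 * m) Hd). rewrite IH in H.
    replace (2 * S m)%nat with (2 * m + 2)%nat by lia.
    assert (P1 := pos_INR d). assert (P2 := pos_INR m).
    assert (P3 := dprod_pos d m). assert (P4 := INR_fact_lt_0 m).
    assert (P5 : 0 < 2 ^ m) by (apply pow_lt; lra).
    rewrite mult_INR in H. change (INR 2) with 2 in H.
    apply (Rmult_eq_reg_l (INR d + 1 + 2 * INR m)); [|lra].
    rewrite H. unfold moment_value. simpl Nat.add at 1 2.
    replace (0 + 2 * S m)%nat with (S (S (2 * m))) by lia.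
    rewrite (fact_S_INR (S (2 * m))), (fact_S_INR (2 * m)), (fact_S_INR m), S_INR, mult_INR.
    simpl. field. repeat split; lra.
Qed.

(** This is the recurrence of [c_n(d,x)] multiplied by [x^k] with [k = n+2m+2]: then
    [k = n + 2(m+1)] and [k+1 = (n+1) + 2(m+1)], whence the index [m + 1] on the right. *)
Lemma moment_value_rec (d n m : nat) :
  (1 <= d)%nat ->
  (INR n + INR d) * moment_value d (n + 2) m =
  (2 * INR n + INR d + 1) * moment_value d (n + 1) (m + 1) - (INR n + 1) * moment_value d n (m + 1).
Proof.
  intro Hd. unfold moment_value.
  replace (n + 2 + 2 * m)%nat with (S (S (n + 2 * m))) by lia.
  replace (n + 1 + 2 * (m + 1))%nat with (S (S (S (n + 2 * m)))) by lia.
  replace (n + 2 * (m + 1))%nat with (S (S (n + 2 * m))) by lia.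
  replace (n + 2 + m)%nat with (S (S (n + m))) by lia.
  replace (n + 1 + (m + 1))%nat with (S (S (n + m))) by lia.
  replace (n + (m + 1))%nat with (S (n + m)) by lia.
  rewrite (fact_S_INR (S (S (n + 2 * m)))).
  replace (m + 1)%nat with (S m) by lia. rewrite (fact_S_INR m).
  assert (P0 := INR_fact_lt_0 (S (S (n + 2 * m)))). set (A := INR (fact (S (S (n + 2 * m))))) in *.
  cbn [odd_step_prod pow].
  rewrite !S_INR, !plus_INR, mult_INR. change (INR 2) with 2.
  assert (P1 := pos_INR d). assert (P2 := pos_INR m). assert (P2' := pos_INR n).
  assert (P3 := dprod_pos d (n + m)). assert (P4 := INR_fact_lt_0 m).
  assert (P5 : 0 < 2 ^ m) by (apply pow_lt; lra).
  field. repeat split; lra.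
Qed.

(** The same recurrence at [k = n]: the cancellation that makes [c_{n+2}] orthogonal to [x^n]. *)
Lemma moment_value_rec0 (d n : nat) :
  (1 <= d)%nat ->
  (2 * INR n + INR d + 1) * moment_value d (n + 1) 0 - (INR n + 1) * moment_value d n 0 = 0.
Proof.
  intro Hd. unfold moment_value. rewrite !Nat.mul_0_r, !Nat.add_0_r, Nat.add_1_r, fact_S_INR.
  cbn [odd_step_prod pow].
  assert (P1 := pos_INR d). assert (P2' := pos_INR n). assert (P3 := dprod_pos d n).
  simpl (INR (fact 0)). field. split; lra.
Qed.

(** * Gegenbauer moments and Schoenberg functions of power series *)

Lemma gegenbauer_rec (lam x : R) (n : nat) :
  (INR n + 2) * gegenbauer lam (S (S n)) x =
  2 * x * (INR n + 1 + lam) * gegenbauer lam (S n) x - (INR n + 2 * lam) * gegenbauer lam n x.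
Proof.
  unfold gegenbauer. simpl. destruct (geg2 lam x n) as [a b]. simpl.
  pose proof (pos_INR n). field. lra.
Qed.

(** At [x = 1] the three-term recurrence collapses to first order, because the induction hypothesis
    turns its last term into a multiple of the middle one. This governs the normalisation in
    [cn]. *)
Lemma gegenbauer_at_1 (lam : R) (n : nat) :
  (INR n + 1) * gegenbauer lam (S n) 1 = (INR n + 2 * lam) * gegenbauer lam n 1.
Proof.
  induction n as [|n IH].
  - unfold gegenbauer; simpl. ring.
  - rewrite S_INR. replace (INR n + 1 + 1) with (INR n + 2) by ring.
    rewrite gegenbauer_rec, <- IH. ring.
Qed.

Lemma gegenbauer_at_1_pos (lam : R) (n : nat) : 0 < lam -> 0 < gegenbauer lam n 1.
Proof.
  intro Hl. induction n as [|n IH]; [unfold gegenbauer; simpl; lra|].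
  pose proof (pos_INR n).
  apply (Rmult_lt_reg_l (INR n + 1)); [lra|]. rewrite gegenbauer_at_1, Rmult_0_r.
  apply Rmult_lt_0_compat; lra.
Qed.

Lemma cn_gegenbauer (d n : nat) (x : R) :
  (2 <= d)%nat ->
  cn d n x = gegenbauer ((INR d - 1) / 2) n x / gegenbauer ((INR d - 1) / 2) n 1.
Proof. intro Hd. destruct d as [|[|d]]; [lia | lia | reflexivity]. Qed.

(** The values at 1 are eliminated by [gegenbauer_at_1]; the parameter enters through
    [d = 2 lam + 1]. *)
Lemma cn_rec (d n : nat) (x : R) :
  (2 <= d)%nat ->
  (INR n + INR d) * cn d (n + 2) x =
  (2 * INR n + INR d + 1) * (x * cn d (n + 1) x) - (INR n + 1) * cn d n x.
Proof.
  intro Hd. rewrite !cn_gegenbauer by exact Hd.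
  replace (n + 2)%nat with (S (S n)) by lia. replace (n + 1)%nat with (S n) by lia.
  assert (Hd' : 2 <= INR d) by (apply (le_INR 2), Hd).
  set (lam := (INR d - 1) / 2).
  assert (Hlam : INR d = 2 * lam + 1) by (unfold lam; field).
  assert (Hl : 0 < lam) by lra.
  assert (P0 := gegenbauer_at_1_pos lam n Hl).
  assert (P1 := gegenbauer_at_1_pos lam (S n) Hl).
  assert (P2 := gegenbauer_at_1_pos lam (S (S n)) Hl).
  assert (E0 := gegenbauer_at_1 lam n). assert (E1 := gegenbauer_at_1 lam (S n)).
  rewrite S_INR in E1. assert (E := gegenbauer_rec lam x n).
  assert (Hn := pos_INR n). rewrite Hlam.
  set (G0 := gegenbauer lam n x) in *. set (G1 := gegenbauer lam (S n) x) in *.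
  set (v0 := gegenbauer lam n 1) in *. set (v1 := gegenbauer lam (S n) 1) in *.
  set (v2 := gegenbauer lam (S (S n)) 1) in *.
  assert (V1 : v1 = (INR n + 2 * lam) * v0 / (INR n + 1)) by (rewrite <- E0; field; lra).
  assert (V2 : v2 = (INR n + 1 + 2 * lam) * v1 / (INR n + 2)) by (rewrite <- E1; field; lra).
  replace (gegenbauer lam (S (S n)) x) with
    ((2 * x * (INR n + 1 + lam) * G1 - (INR n + 2 * lam) * G0) / (INR n + 2))
    by (rewrite <- E; field; lra).
  rewrite V2, V1. field. repeat split; lra.
Qed.

Lemma cn_0 (d : nat) (x : R) : (2 <= d)%nat -> cn d 0 x = 1.
Proof. intro Hd. rewrite cn_gegenbauer by exact Hd. unfold gegenbauer; simpl. field. Qed.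

Lemma cn_1 (d : nat) (x : R) : (2 <= d)%nat -> cn d 1 x = x.
Proof.
  intro Hd. rewrite cn_gegenbauer by exact Hd. unfold gegenbauer; simpl.
  assert (2 <= INR d) by (apply (le_INR 2), Hd). field. lra.
Qed.

Lemma continuous_cn (d n : nat) (x : R) : (2 <= d)%nat -> continuous (cn d n) x.
Proof.
  intro Hd.
  assert (H : continuous (cn d n) x /\ continuous (cn d (S n)) x); [|apply H].
  assert (Hd' : 2 <= INR d) by (apply (le_INR 2), Hd).
  induction n as [|n [IH0 IH1]].
  - split.
    + apply (continuous_ext (fun _ => 1)); [intro; now rewrite cn_0 | apply continuous_const].
    + apply (continuous_ext (fun y => y)); [intro; now rewrite cn_1 | apply continuous_id].
  - split; [exact IH1|]. assert (Hn := pos_INR n).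
    apply (continuous_ext (fun y => (2 * INR n + INR d + 1) / (INR n + INR d) * (y * cn d (S n) y)
                                    + - (INR n + 1) / (INR n + INR d) * cn d n y)).
    + intro y. assert (E := cn_rec d n y Hd).
      rewrite Nat.add_1_r in E. replace (n + 2)%nat with (S (S n)) in E by lia.
      apply (Rmult_eq_reg_l (INR n + INR d)); [|lra]. rewrite E. field. lra.
    + apply continuous_Rplus.
      * apply continuous_Rmult; [apply continuous_const|].
        apply continuous_Rmult; [apply continuous_id | exact IH1].
      * apply continuous_Rmult; [apply continuous_const | exact IH0].
Qed.

Definition gegenbauer_moment (d k n : nat) : R := sphere_mean d (fun x => x ^ k * cn d n x).

Lemma gegenbauer_moment_rec (d k n : nat) :
  (2 <= d)%nat ->
  (INR n + INR d) * gegenbauer_moment d k (n + 2) =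
  (2 * INR n + INR d + 1) * gegenbauer_moment d (k + 1) (n + 1) - (INR n + 1) * gegenbauer_moment d k n.
Proof.
  intro Hd. unfold gegenbauer_moment.
  assert (C : forall i j x, continuous (fun x => x ^ i * cn d j x) x).
  { intros. apply continuous_Rmult; [apply continuous_pow | now apply continuous_cn]. }
  unfold Rminus. rewrite Ropp_mult_distr_l, <- !sphere_mean_scal by apply C.
  rewrite <- sphere_mean_plus by (intro; apply continuous_Rmult; [apply continuous_const | apply C]).
  apply sphere_mean_ext. intros x _.
  transitivity (x ^ k * ((INR n + INR d) * cn d (n + 2) x)); [ring|].
  rewrite cn_rec by exact Hd. rewrite pow_add. ring.
Qed.

(** All three claims are carried together for two consecutive values of [n], as a three-term
    recurrence requires. The second is parity, the third orthogonality to lower powers. *)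
Lemma gegenbauer_moment_values (d n : nat) :
  (2 <= d)%nat ->
  (forall m, gegenbauer_moment d (n + 2 * m) n = moment_value d n m) /\
  (forall m, gegenbauer_moment d (n + 2 * m + 1) n = 0) /\
  (forall k, (k < n)%nat -> gegenbauer_moment d k n = 0).
Proof.
  intro Hd. assert (Hd' : 2 <= INR d) by (apply (le_INR 2), Hd).
  pose (Q := fun n => (forall m, gegenbauer_moment d (n + 2 * m) n = moment_value d n m) /\
    (forall m, gegenbauer_moment d (n + 2 * m + 1) n = 0) /\
    (forall k, (k < n)%nat -> gegenbauer_moment d k n = 0)).
  assert (H : Q n /\ Q (S n)); [|apply H].
  induction n as [|n [IH0 IH1]].
  - assert (E0 : forall k, gegenbauer_moment d k 0 = sphere_mean d (fun x => x ^ k)).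
    { intro k. apply sphere_mean_ext. intros x _. rewrite cn_0 by exact Hd. ring. }
    assert (E1 : forall k, gegenbauer_moment d k 1 = sphere_mean d (fun x => x ^ (k + 1))).
    { intro k. apply sphere_mean_ext. intros x _. rewrite cn_1, pow_add by exact Hd. ring. }
    split; unfold Q.
    + split; [|split; [|lia]]; intro m; rewrite E0; [now apply sphere_mean_even | now apply sphere_mean_odd].
    + split; [|split].
      * intro m. rewrite E1. replace (1 + 2 * m + 1)%nat with (2 * (m + 1))%nat by lia.
        rewrite sphere_mean_even by exact Hd. unfold moment_value.
        replace (0 + 2 * (m + 1))%nat with (S (1 + 2 * m)) by lia.
        replace (0 + (m + 1))%nat with (1 + m)%nat by lia.
        rewrite fact_S_INR, Nat.add_1_r, (fact_S_INR m), plus_INR, mult_INR.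
        change (INR 1) with 1. change (INR 2) with 2.
        assert (Hm := pos_INR m). assert (P := dprod_pos d (1 + m)).
        assert (P4 := INR_fact_lt_0 m). assert (P5 : 0 < 2 ^ m) by (apply pow_lt; lra).
        change (2 ^ S m) with (2 * 2 ^ m).
        field. repeat split; lra.
      * intro m. rewrite E1. replace (1 + 2 * m + 1 + 1)%nat with (2 * (m + 1) + 1)%nat by lia.
        now apply sphere_mean_odd.
      * intros k Hk. assert (k = 0)%nat by lia. subst k. rewrite E1. now apply (sphere_mean_odd d 0).
  - split; [exact IH1|].
    destruct IH0 as [A0 [B0 C0]], IH1 as [A1 [B1 C1]].
    assert (Hn := pos_INR n).
    assert (R1 : forall k, (INR n + INR d) * gegenbauer_moment d k (S (S n)) =
       (2 * INR n + INR d + 1) * gegenbauer_moment d (k + 1) (S n) - (INR n + 1) * gegenbauer_moment d k n).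
    { intro k. assert (E := gegenbauer_moment_rec d k n Hd).
      rewrite (Nat.add_1_r n) in E. replace (n + 2)%nat with (S (S n)) in E by lia. exact E. }
    split; [|split].
    + intro m. apply (Rmult_eq_reg_l (INR n + INR d)); [|lra]. rewrite R1.
      replace (S (S n) + 2 * m + 1)%nat with (S n + 2 * (m + 1))%nat by lia.
      replace (S (S n) + 2 * m)%nat with (n + 2 * (m + 1))%nat by lia.
      rewrite A0, A1. replace (S (S n)) with (n + 2)%nat by lia.
      rewrite moment_value_rec by lia. now rewrite (Nat.add_1_r n).
    + intro m. apply (Rmult_eq_reg_l (INR n + INR d)); [|lra]. rewrite R1.
      replace (S (S n) + 2 * m + 1 + 1)%nat with (S n + 2 * (m + 1) + 1)%nat by lia.
      replace (S (S n) + 2 * m + 1)%nat with (n + 2 * (m + 1) + 1)%nat by lia.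
      rewrite B0, B1. ring.
    + intros k Hk. apply (Rmult_eq_reg_l (INR n + INR d)); [|lra]. rewrite R1, Rmult_0_r.
      (* For [k = n] both terms are nonzero and cancel by [moment_value_rec0]; for [k = n+1] both
         vanish by parity; for [k < n] both vanish by orthogonality at the two previous levels. *)
      destruct (Nat.eq_dec k n) as [->|H1]; [|destruct (Nat.eq_dec k (S n)) as [->|H2]].
      * assert (E1 := A1 0%nat). assert (E0 := A0 0%nat). rewrite Nat.mul_0_r, Nat.add_0_r in E0, E1.
        rewrite Nat.add_1_r, E0, E1, <- Nat.add_1_r. apply moment_value_rec0. lia.
      * assert (E1 := B1 0%nat). assert (E0 := B0 0%nat). rewrite Nat.mul_0_r, Nat.add_0_r in E0, E1.
        rewrite E1, <- (Nat.add_1_r n), E0. ring.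
      * rewrite C0, C1 by lia. ring.
Qed.

Lemma moment_value_pos (d n m : nat) : 0 < moment_value d n m.
Proof.
  unfold moment_value. apply Rdiv_lt_0_compat; [apply INR_fact_lt_0|].
  repeat apply Rmult_lt_0_compat;
    [apply pow_lt; lra | apply INR_fact_lt_0 | apply dprod_pos].
Qed.

Lemma moment_value_step (d n m : nat) :
  moment_value d n (S m) * (2 * (INR m + 1) * (INR d + 1 + 2 * (INR n + INR m))) =
  (INR n + 2 * INR m + 2) * (INR n + 2 * INR m + 1) * moment_value d n m.
Proof.
  unfold moment_value.
  replace (n + 2 * S m)%nat with (S (S (n + 2 * m))) by lia.
  replace (n + S m)%nat with (S (n + m)) by lia.
  rewrite (fact_S_INR (S (n + 2 * m))), (fact_S_INR (n + 2 * m)), (fact_S_INR m).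
  cbn [odd_step_prod pow]. rewrite S_INR, !plus_INR, mult_INR. change (INR 2) with 2.
  assert (P1 := pos_INR d). assert (P2 := pos_INR m). assert (P2' := pos_INR n).
  assert (P3 := dprod_pos d (n + m)). assert (P4 := INR_fact_lt_0 m).
  assert (P5 : 0 < 2 ^ m) by (apply pow_lt; lra).
  field. repeat split; lra.
Qed.

(** For [m = 0] this is an equality. Afterwards the ratio of consecutive values is at most 1, so the
    bound persists for every [m]. *)
Lemma moment_value_decr (d n m : nat) :
  (INR n + 1) * (INR n + 2) <= 2 * INR d ->
  moment_value d n (S m) <= moment_value d n 0 * ((INR n + 1) * (INR n + 2) / (2 * (INR d + 1 + 2 * INR n))).
Proof.
  intro Hnd. assert (P1 := pos_INR d). assert (P2' := pos_INR n).
  induction m as [|m IH].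
  - assert (E := moment_value_step d n 0). simpl (INR 0) in E. right.
    apply (Rmult_eq_reg_r (2 * (INR d + 1 + 2 * INR n))); [|lra].
    transitivity ((INR n + 2) * (INR n + 1) * moment_value d n 0); [lra|]. field. lra.
  - apply Rle_trans with (2 := IH).
    assert (E := moment_value_step d n (S m)). assert (P2 := pos_INR (S m)).
    assert (P3 := moment_value_pos d n (S m)).
    set (a := 2 * (INR (S m) + 1) * (INR d + 1 + 2 * (INR n + INR (S m)))) in *.
    set (b := (INR n + 2 * INR (S m) + 2) * (INR n + 2 * INR (S m) + 1)) in *.
    (* Writing [m] for [S m], the difference [a - b] equals [(2d - (n+1)(n+2)) + 2md + 4n + 2],
       which is where [Hnd] enters. *)
    assert (Hab : b <= a) by (unfold a, b; nra).
    assert (Ha : 0 < a) by (unfold a; apply Rmult_lt_0_compat; lra).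
    apply (Rmult_le_reg_r a); [exact Ha|]. rewrite E, (Rmult_comm b).
    apply Rmult_le_compat_l; lra.
Qed.

Lemma is_lim_seq_const_over_INR (c b : R) : is_lim_seq (fun d => c / (INR d + b)) 0.
Proof.
  replace (Finite 0) with (Rbar_mult c 0) by (simpl; f_equal; ring).
  apply (is_lim_seq_scal_l (fun d => / (INR d + b)) c 0).
  replace (Finite 0) with (Rbar_inv p_infty) by reflexivity.
  apply is_lim_seq_inv; [|discriminate].
  eapply is_lim_seq_plus; [apply is_lim_seq_INR | apply is_lim_seq_const | reflexivity].
Qed.

(** Both are monic polynomials in [d] of degree [m]; each pair of factors has quotient
    [(d+i)/(d+1+2i) = 1 - (i+1)/(d+1+2i)]. *)
Lemma poch_dprod_lim (m : nat) : is_lim_seq (fun d => poch (INR d) m / odd_step_prod d m) 1.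
Proof.
  induction m as [|m IH].
  - apply (is_lim_seq_ext (fun _ => 1)); [intro; simpl; field | apply is_lim_seq_const].
  - apply (is_lim_seq_ext (fun d => poch (INR d) m / odd_step_prod d m *
                             (1 - (INR m + 1) / (INR d + (1 + 2 * INR m))))).
    + intro d. simpl. assert (P := dprod_pos d m).
      pose proof (pos_INR m). pose proof (pos_INR d). field. split; lra.
    + replace (Finite 1) with (Finite (1 * (1 - 0))) by (f_equal; ring).
      apply is_lim_seq_mult'; [exact IH|].
      apply is_lim_seq_minus'; [apply is_lim_seq_const | apply is_lim_seq_const_over_INR].
Qed.

(** For [n >= 1], [n!] cancels and the factor [d+2n-1] of [Ndim n d] is the last factor of
    [odd_step_prod d n]. What remains is the quotient of [poch_dprod_lim] with [m = n-1]. *)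
Lemma Ndim_moment_lim (n : nat) : is_lim_seq (fun d => Ndim n d * moment_value d n 0) 1.
Proof.
  destruct n as [|m].
  - apply (is_lim_seq_ext (fun _ => 1)); [intro; unfold moment_value; simpl; field | apply is_lim_seq_const].
  - apply (is_lim_seq_ext (fun d => poch (INR d) m / odd_step_prod d m)); [|apply poch_dprod_lim].
    intro d. unfold Ndim, moment_value. rewrite Nat.mul_0_r, !Nat.add_0_r.
    cbn [odd_step_prod pow]. change (INR (fact 0)) with 1. rewrite S_INR.
    assert (P := dprod_pos d m). assert (P4 := INR_fact_lt_0 (S m)).
    pose proof (pos_INR m). pose proof (pos_INR d). field. repeat split; lra.
Qed.

(** The first summand is the error at [k = n]; the second dominates every [k = n+2m] with [m >= 1].
    The remaining moments vanish. *)
Definition schoenberg_error (n d : nat) : R :=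
  Rabs (Ndim n d * moment_value d n 0 - 1) +
  Rabs (Ndim n d * moment_value d n 0) * ((INR n + 1) * (INR n + 2) / (2 * (INR d + 1 + 2 * INR n))).

Lemma schoenberg_error_lim (n : nat) : is_lim_seq (schoenberg_error n) 0.
Proof.
  assert (H := Ndim_moment_lim n). unfold schoenberg_error.
  replace (Finite 0) with (Finite (Rabs (1 - 1) + Rabs 1 * 0))
    by (f_equal; rewrite Rminus_diag, Rabs_R0; ring).
  apply is_lim_seq_plus'.
  - apply (is_lim_seq_abs _ (1 - 1)). apply is_lim_seq_minus'; [exact H | apply is_lim_seq_const].
  - apply is_lim_seq_mult'; [now apply (is_lim_seq_abs _ 1)|].
    apply (is_lim_seq_ext (fun d => (INR n + 1) * (INR n + 2) / 2 / (INR d + (1 + 2 * INR n))));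
      [|apply is_lim_seq_const_over_INR].
    intro d. pose proof (pos_INR d). pose proof (pos_INR n). field. lra.
Qed.

Lemma Ndim_nonneg (n d : nat) : (1 <= d)%nat -> 0 <= Ndim n d.
Proof.
  intro Hd. destruct n as [|m]; simpl Ndim; [lra|].
  assert (Hd' : 1 <= INR d) by (apply (le_INR 1), Hd).
  assert (P : 0 <= poch (INR d) m).
  { induction m as [|m IH]; simpl; [lra|]. pose proof (pos_INR m). apply Rmult_le_pos; lra. }
  apply Rmult_le_pos; [|pose proof (pos_INR (S m)); simpl in *; lra].
  apply Rdiv_le_0_compat; [exact P|]. apply (INR_fact_lt_0 (S m)).
Qed.

Lemma gegenbauer_moment_delta (n d k : nat) :
  (2 <= d)%nat -> (INR n + 1) * (INR n + 2) <= 2 * INR d ->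
  Rabs (Ndim n d * gegenbauer_moment d k n - (if Nat.eqb k n then 1 else 0)) <= schoenberg_error n d.
Proof.
  intros Hd Hnd. destruct (gegenbauer_moment_values d n Hd) as [A [B C]].
  assert (P1 := pos_INR d). assert (P2 := pos_INR n). assert (PN := Ndim_nonneg n d ltac:(lia)).
  assert (Pg := moment_value_pos d n 0).
  assert (Pq : 0 <= (INR n + 1) * (INR n + 2) / (2 * (INR d + 1 + 2 * INR n)))
    by (apply Rdiv_le_0_compat; nra).
  set (q := (INR n + 1) * (INR n + 2) / (2 * (INR d + 1 + 2 * INR n))) in *.
  assert (PQ : 0 <= Ndim n d * moment_value d n 0) by (apply Rmult_le_pos; lra).
  unfold schoenberg_error. fold q. rewrite (Rabs_pos_eq _ PQ).
  assert (Q1 := Rabs_pos (Ndim n d * moment_value d n 0 - 1)).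
  assert (Q2 : 0 <= Ndim n d * moment_value d n 0 * q) by now apply Rmult_le_pos.
  destruct (Nat.eqb_spec k n) as [-> | Hk].
  - assert (E := A 0%nat). rewrite Nat.mul_0_r, Nat.add_0_r in E. rewrite E. lra.
  - rewrite Rminus_0_r.
    assert (Hz : gegenbauer_moment d k n = 0 -> Rabs (Ndim n d * gegenbauer_moment d k n) <=
                 Rabs (Ndim n d * moment_value d n 0 - 1) + Ndim n d * moment_value d n 0 * q).
    { intros ->. rewrite Rmult_0_r, Rabs_R0. lra. }
    destruct (Nat.lt_ge_cases k n) as [Hlt | Hge]; [now apply Hz, C|].
    destruct (Nat.Even_or_Odd (k - n)) as [[m Hm] | [m Hm]].
    + destruct m as [|m]; [lia|]. replace k with (n + 2 * S m)%nat by lia. rewrite A.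
      assert (D := moment_value_decr d n m Hnd). fold q in D. assert (P3 := moment_value_pos d n (S m)).
      rewrite Rabs_pos_eq by (apply Rmult_le_pos; lra).
      apply Rle_trans with (Ndim n d * (moment_value d n 0 * q)); [apply Rmult_le_compat_l; lra | lra].
    + apply Hz. replace k with (n + 2 * m + 1)%nat by lia. apply B.
Qed.

(** * Schoenberg integrals of uniformly convergent power series *)

Definition cont_on_I (F : R -> R) : Prop :=
  forall x eps, -1 <= x <= 1 -> 0 < eps ->
    exists delta, 0 < delta /\
      forall y, -1 <= y <= 1 -> Rabs (y - x) < delta -> Rabs (F y - F x) < eps.

(** Retraction onto [[-1,1]]: it replaces a function known to be continuous only there by one
    continuous on the whole line, with the same values on [[-1,1]]. *)
Definition clamp (x : R) : R := Rmax (-1) (Rmin 1 x).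

Lemma clamp_I (x : R) : -1 <= clamp x <= 1.
Proof.
  unfold clamp. split; [apply Rmax_l|]. apply Rmax_lub; [lra | apply Rmin_l].
Qed.

Lemma clamp_id (x : R) : -1 <= x <= 1 -> clamp x = x.
Proof. intro H. unfold clamp. rewrite Rmin_right, Rmax_right by lra. reflexivity. Qed.

Lemma clamp_dist (x y : R) : Rabs (clamp y - clamp x) <= Rabs (y - x).
Proof.
  unfold clamp, Rmax, Rmin.
  repeat destruct Rle_dec; unfold Rabs; repeat destruct Rcase_abs; lra.
Qed.

Lemma continuous_clamp (F : R -> R) (x : R) :
  cont_on_I F -> continuous (fun y => F (clamp y)) x.
Proof.
  intro HF. apply continuity_pt_filterlim. intros eps Heps.
  destruct (HF (clamp x) eps (clamp_I x) Heps) as [delta [Hd H]].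
  exists delta. split; [exact Hd|]. intros y [_ Hy]. simpl in *. unfold R_dist in *.
  apply H; [apply clamp_I|]. eapply Rle_lt_trans; [apply clamp_dist | exact Hy].
Qed.

Definition poly_sum (a : nat -> R) (m : nat) (x : R) : R := sum_f_R0 (fun k => a k * x ^ k) m.

Lemma continuous_psum (a : nat -> R) (m : nat) (x : R) : continuous (poly_sum a m) x.
Proof.
  unfold poly_sum. induction m as [|m IH]; simpl sum_f_R0.
  - apply continuous_Rmult; [apply continuous_const | apply (continuous_pow 0)].
  - apply continuous_Rplus; [exact IH|].
    apply continuous_Rmult; [apply continuous_const | apply (continuous_pow (S m))].
Qed.

Lemma sphere_mean_psum (d n m : nat) (a : nat -> R) :
  (2 <= d)%nat ->
  sphere_mean d (fun x => poly_sum a m x * cn d n x) = sum_f_R0 (fun k => a k * gegenbauer_moment d k n) m.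
Proof.
  intro Hd.
  assert (C : forall i x, continuous (fun x => x ^ i * cn d n x) x).
  { intros. apply continuous_Rmult; [apply continuous_pow | now apply continuous_cn]. }
  induction m as [|m IH].
  - simpl. unfold gegenbauer_moment. rewrite <- sphere_mean_scal by apply (C 0%nat). apply sphere_mean_ext.
    intros; unfold poly_sum; simpl; ring.
  - rewrite tech5, <- IH. unfold gegenbauer_moment. rewrite <- sphere_mean_scal by apply C.
    rewrite <- sphere_mean_plus.
    + apply sphere_mean_ext. intros x _. unfold poly_sum. rewrite tech5. ring.
    + intro x. apply continuous_Rmult; [apply continuous_psum | now apply continuous_cn].
    + intro x. apply continuous_Rmult; [apply continuous_const | apply C].
Qed.

(** The constant may depend on [d]: it serves to remove a truncation error at fixed [d]. *)
Lemma sphere_mean_bound (d : nat) (p : R -> R) :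
  (2 <= d)%nat -> (forall x, continuous p x) ->
  exists B, forall q eps, (forall x, continuous q x) ->
    (forall x, -1 <= x <= 1 -> Rabs (q x) <= eps) -> Rabs (sphere_mean d (fun x => q x * p x)) <= B * eps.
Proof.
  intros Hd Hp.
  destruct (bounded_continuity (V := R_NormedModule) (fun x => p x * weight d x) (-1) 1) as [B HB].
  { intros x _. apply continuous_Rmult; [apply Hp | apply continuous_weight]. }
  exists (Rabs (sigma (d - 1) / sigma d) * (2 * B)). intros q eps Hq Hqe.
  unfold sphere_mean. rewrite Rabs_mult, Rmult_assoc. apply Rmult_le_compat_l; [apply Rabs_pos|].
  replace (2 * B * eps) with ((1 - -1) * (B * eps)) by ring.
  apply abs_RInt_le_const; [lra | | ].
  - apply ex_RInt_weight. intro; now apply continuous_Rmult.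
  - intros x Hx. rewrite Rmult_assoc, Rabs_mult, Rmult_comm.
    specialize (HB x Hx). specialize (Hqe x Hx). unfold norm in HB; simpl in HB.
    unfold abs in HB; simpl in HB. apply Rmult_le_compat; try apply Rabs_pos; lra.
Qed.

Lemma sum_Rabs_mult_le (a b : nat -> R) (m : nat) (c : R) :
  (forall k, Rabs (b k) <= c) ->
  Rabs (sum_f_R0 (fun k => a k * b k) m) <= c * sum_f_R0 (fun k => Rabs (a k)) m.
Proof.
  intro Hb. rewrite scal_sum. eapply Rle_trans; [apply Rsum_abs|].
  apply sum_Rle. intros k _. rewrite Rabs_mult.
  apply Rmult_le_compat_l; [apply Rabs_pos | apply Hb].
Qed.

Lemma sum_delta (a : nat -> R) (n m : nat) :
  (n <= m)%nat -> sum_f_R0 (fun k => a k * (if Nat.eqb k n then 1 else 0)) m = a n.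
Proof.
  assert (Z : forall j, (j < n)%nat ->
                sum_f_R0 (fun k => a k * (if Nat.eqb k n then 1 else 0)) j = 0).
  { induction j as [|j IH]; intro Hj; cbn [sum_f_R0].
    - destruct (Nat.eqb_spec 0 n); [lia | ring].
    - rewrite IH by lia. destruct (Nat.eqb_spec (S j) n); [lia | ring]. }
  induction m as [|m IH]; intro Hm.
  - assert (n = 0%nat) by lia; subst. simpl. ring.
  - rewrite tech5. destruct (Nat.eqb_spec (S m) n) as [<- | Hne].
    + rewrite Z by lia. ring.
    + rewrite IH by lia. ring.
Qed.

(** For the truncated series the difference is [sum a_k (A_k - delta_kn)], hence at most
    [schoenberg_error n d * M]. Replacing the truncation by [F] costs, at fixed [d], a multiple of
    the uniform truncation error, which is arbitrarily small. *)
Lemma schoenberg_component (n d : nat) (F : R -> R) (a : nat -> R) (M : R) :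
  (2 <= d)%nat -> (INR n + 1) * (INR n + 2) <= 2 * INR d ->
  cont_on_I F ->
  (forall m, sum_f_R0 (fun k => Rabs (a k)) m <= M) ->
  (forall eps, 0 < eps -> exists N, forall m, (N <= m)%nat -> forall x, -1 <= x <= 1 ->
      Rabs (poly_sum a m x - F x) <= eps) ->
  Rabs (Ndim n d * sigma (d - 1) / sigma d * RInt (fun x => cn d n x * weight d x * F x) (-1) 1
        - a n) <= schoenberg_error n d * M.
Proof.
  intros Hd Hnd HF HM Hunif.
  set (G := fun x => F (clamp x)).
  assert (HG : forall x, continuous G x) by (intro; now apply continuous_clamp).
  assert (Hc : forall x, continuous (cn d n) x) by (intro; now apply continuous_cn).
  assert (HGc : forall x, continuous (fun y => G y * cn d n y) x)
    by (intro; apply continuous_Rmult; auto).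
  assert (E : Ndim n d * sigma (d - 1) / sigma d *
              RInt (fun x => cn d n x * weight d x * F x) (-1) 1
              = Ndim n d * sphere_mean d (fun x => G x * cn d n x)).
  { rewrite (RInt_of_is_RInt _ _ _ (RInt.RInt (fun x => G x * cn d n x * weight d x) (-1) 1)).
    - unfold sphere_mean, Rdiv. ring.
    - eapply is_RInt_ext; [|apply (RInt_correct (V := R_CompleteNormedModule)), ex_RInt_weight, HGc].
      intros x. rewrite Rmin_left, Rmax_right by lra. intro Hx.
      unfold G. rewrite clamp_id by lra. eqR. ring. }
  rewrite E.
  assert (HM0 : 0 <= M).
  { eapply Rle_trans; [|apply (HM 0%nat)]. apply Rabs_pos. }
  destruct (sphere_mean_bound d (cn d n) Hd Hc) as [B HB].
  assert (PN := Ndim_nonneg n d ltac:(lia)).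
  apply le_epsilon. intros eps Heps.
  (* [C] dominates the factor [Ndim n d * Rabs B] of the truncation error; the added 1 makes it a
     legitimate divisor. *)
  set (C := Ndim n d * Rabs B + 1).
  assert (HC : 0 < C) by (unfold C; pose proof (Rmult_le_pos _ _ PN (Rabs_pos B)); lra).
  destruct (Hunif (eps / C)) as [N HN]; [now apply Rdiv_lt_0_compat|].
  (* Large enough for the uniform bound, and at least [n] so that the term [a n] occurs in the
     sum. *)
  set (m := (N + n)%nat).
  assert (Hdiff : Rabs (sphere_mean d (fun x => (G x + -1 * poly_sum a m x) * cn d n x)) <= Rabs B * (eps / C)).
  { eapply Rle_trans; [apply (HB _ (eps / C))|].
    - intro x. apply continuous_Rplus; [apply HG|].
      apply continuous_Rmult; [apply continuous_const | apply continuous_psum].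
    - intros x Hx. unfold G. rewrite clamp_id by exact Hx.
      replace (F x + -1 * poly_sum a m x) with (- (poly_sum a m x - F x)) by ring.
      rewrite Rabs_Ropp. apply HN; [unfold m; lia | exact Hx].
    - apply Rmult_le_compat_r; [apply Rlt_le, Rdiv_lt_0_compat; lra | apply Rle_abs]. }
  assert (Hsplit : sphere_mean d (fun x => (G x + -1 * poly_sum a m x) * cn d n x) =
                   sphere_mean d (fun x => G x * cn d n x)
                   - sum_f_R0 (fun k => a k * gegenbauer_moment d k n) m).
  { rewrite <- sphere_mean_psum by exact Hd.
    transitivity (sphere_mean d (fun x => G x * cn d n x + -1 * (poly_sum a m x * cn d n x))).
    - apply sphere_mean_ext. intros; ring.
    - assert (Cp : forall x, continuous (fun y => poly_sum a m y * cn d n y) x)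
        by (intro; apply continuous_Rmult; [apply continuous_psum | apply Hc]).
      rewrite sphere_mean_plus, sphere_mean_scal; [ring | exact Cp | exact HGc |].
      intro. apply continuous_Rmult; [apply continuous_const | apply Cp]. }
  rewrite Hsplit in Hdiff.
  set (W := sphere_mean d (fun x => G x * cn d n x)) in *.
  set (T := sum_f_R0 (fun k => a k * gegenbauer_moment d k n) m) in *.
  assert (HT : Rabs (Ndim n d * T - a n) <= schoenberg_error n d * M).
  { rewrite <- (sum_delta a n m) by (unfold m; lia). unfold T. rewrite scal_sum, <- minus_sum.
    rewrite (sum_eq _ (fun k => a k * (Ndim n d * gegenbauer_moment d k n - (if Nat.eqb k n then 1 else 0))))
      by (intros; ring).
    eapply Rle_trans; [apply sum_Rabs_mult_le; intro k; now apply gegenbauer_moment_delta|].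
    apply Rmult_le_compat_l; [|apply HM].
    eapply Rle_trans; [apply Rabs_pos | now apply (gegenbauer_moment_delta n d 0)]. }
  replace (Ndim n d * W - a n) with (Ndim n d * (W - T) + (Ndim n d * T - a n)) by ring.
  eapply Rle_trans; [apply Rabs_triang|]. rewrite Rplus_comm. apply Rplus_le_compat; [exact HT|].
  rewrite Rabs_mult, (Rabs_pos_eq _ PN).
  apply Rle_trans with (Ndim n d * (Rabs B * (eps / C))); [now apply Rmult_le_compat_l|].
  apply Rle_trans with (C * (eps / C)); [|right; field; lra].
  rewrite <- Rmult_assoc. apply Rmult_le_compat_r; [|unfold C; lra].
  apply Rlt_le, Rdiv_lt_0_compat; lra.
Qed.

(** * Positive definiteness of the Bernstein coefficients *)

Lemma Cpx_ext (z w : Cpx) : Cre z = Cre w -> Cim z = Cim w -> z = w.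
Proof. destruct z, w; simpl; intros; subst; reflexivity. Qed.

Lemma Csum_ext (n : nat) (g h : nat -> Cpx) :
  (forall k, (k < n)%nat -> g k = h k) -> Csum n g = Csum n h.
Proof.
  induction n as [|n IH]; intro H; simpl; [reflexivity|].
  rewrite IH by (intros; apply H; lia). now rewrite H by lia.
Qed.

Lemma Csum_app (n m : nat) (g : nat -> Cpx) :
  Csum (n + m) g = Cadd (Csum n g) (Csum m (fun k => g (n + k)%nat)).
Proof.
  induction m as [|m IH]; simpl.
  - rewrite Nat.add_0_r. apply Cpx_ext; simpl; ring.
  - rewrite Nat.add_succ_r. simpl. rewrite IH. apply Cpx_ext; simpl; ring.
Qed.

Lemma Csum_Cadd (n : nat) (g h : nat -> Cpx) :
  Csum n (fun k => Cadd (g k) (h k)) = Cadd (Csum n g) (Csum n h).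
Proof.
  induction n as [|n IH]; simpl; [apply Cpx_ext; simpl; ring|].
  rewrite IH. apply Cpx_ext; simpl; ring.
Qed.

Lemma Csum_Cscale (a : R) (n : nat) (g : nat -> Cpx) :
  Csum n (fun k => Cscale a (g k)) = Cscale a (Csum n g).
Proof.
  induction n as [|n IH]; simpl; [apply Cpx_ext; simpl; ring|].
  rewrite IH. apply Cpx_ext; simpl; ring.
Qed.

Lemma Csum2_app (n : nat) (g : nat -> nat -> Cpx) :
  Csum (n + n) (fun j => Csum (n + n) (g j)) =
  Csum n (fun j => Csum n (fun l =>
    Cadd (Cadd (g j l) (g j (n + l)%nat)) (Cadd (g (n + j)%nat l) (g (n + j)%nat (n + l)%nat)))).
Proof.
  rewrite Csum_app, <- Csum_Cadd. apply Csum_ext. intros j _.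
  rewrite !Csum_app, <- !Csum_Cadd. reflexivity.
Qed.

Lemma Cnonneg_add (z w : Cpx) : Cnonneg z -> Cnonneg w -> Cnonneg (Cadd z w).
Proof. intros [Hz1 Hz2] [Hw1 Hw2]. split; simpl; lra. Qed.

Lemma Cnonneg_scale (a : R) (z : Cpx) : 0 <= a -> Cnonneg z -> Cnonneg (Cscale a z).
Proof. intros Ha [Hz1 Hz2]. split; simpl; [rewrite Hz1; ring | now apply Rmult_le_pos]. Qed.

Lemma pos_def_kernel_ext (X : Type) (k1 k2 : X -> X -> Cpx) :
  (forall x y, k1 x y = k2 x y) -> pos_def_kernel X k1 -> pos_def_kernel X k2.
Proof.
  intros E H n x c. erewrite Csum_ext; [apply (H n x c)|].
  intros j _. apply Csum_ext. intros l _. now rewrite E.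
Qed.

Lemma pos_def_kernel_add (X : Type) (k1 k2 : X -> X -> Cpx) :
  pos_def_kernel X k1 -> pos_def_kernel X k2 ->
  pos_def_kernel X (fun x y => Cadd (k1 x y) (k2 x y)).
Proof.
  intros H1 H2 n x c. 
  assert (H := Cnonneg_add _ _ (H1 n x c) (H2 n x c)).
  rewrite <- Csum_Cadd in H. erewrite Csum_ext; [exact H|].
  intros j _; cbv beta. rewrite <- Csum_Cadd. apply Csum_ext; intros l _.
  apply Cpx_ext; simpl; ring.
Qed.

Lemma pos_def_kernel_scale (X : Type) (a : R) (k : X -> X -> Cpx) :
  0 <= a -> pos_def_kernel X k -> pos_def_kernel X (fun x y => Cscale a (k x y)).
Proof.
  intros Ha H n x c.
  assert (H' := Cnonneg_scale _ _ Ha (H n x c)).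
  rewrite <- Csum_Cscale in H'. erewrite Csum_ext; [exact H'|].
  intros j _; cbv beta. rewrite <- Csum_Cscale. apply Csum_ext; intros l _.
  apply Cpx_ext; simpl; ring.
Qed.

Section CubePositivity.
Variable L : LCGroup.

(** Reads [M] coordinates, where [dotp d] reads [d + 1]; the empty product [M = 0] ends the
    induction on the number of signs. *)
Fixpoint dot (M : nat) (z z' : nat -> R) : R :=
  match M with O => 0 | S m => dot m z z' + z m * z' m end.

Lemma dot_ext (M : nat) (z z' w w' : nat -> R) :
  (forall i, (i < M)%nat -> z i = w i /\ z' i = w' i) -> dot M z z' = dot M w w'.
Proof.
  induction M as [|M IH]; intro H; simpl; [reflexivity|].
  rewrite IH by (intros; apply H; lia). destruct (H M) as [-> ->]; [lia|reflexivity].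
Qed.

Definition is_sign (s : R) : Prop := s = 1 \/ s = -1.

(** Positive definiteness of [h(z.z', u^-1 v)] on [{-1,1}^M x L]. Points are infinite sign
    sequences, of which [dot M] reads only the first [M] entries. *)
Definition cube_pos (M : nat) (h : R -> L -> Cpx) : Prop :=
  forall (n : nat) (z : nat -> nat -> R) (u : nat -> L) (c : nat -> Cpx),
    (forall k i, is_sign (z k i)) ->
    Cnonneg (Csum n (fun j => Csum n (fun l =>
       Cmul (Cmul (h (dot M (z j) (z l)) (gmul (ginv (u j)) (u l))) (c j)) (Cconj (c l))))).

(* Doubling a configuration: the last coordinate of the copies is [1] and [-1], and the
   weights of the second copy are multiplied by [s]. *)
Lemma cube_pos_step (M : nat) (s : R) (h : R -> L -> Cpx) :
  is_sign s -> cube_pos (S M) h ->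
  cube_pos M (fun t v => Cadd (h (t + 1) v) (Cscale s (h (t - 1) v))).
Proof.
  intros Hs Hh n z u c Hz.
  set (z' := fun k i => if (i <? M)%nat then z (if (k <? n)%nat then k else (k - n)%nat) i
                        else if (k <? n)%nat then 1 else -1).
  set (u' := fun k => u (if (k <? n)%nat then k else (k - n)%nat)).
  set (c' := fun k => if (k <? n)%nat then c k else Cscale s (c (k - n)%nat)).
  assert (Hz' : forall k i, is_sign (z' k i)).
  { intros k i. unfold z'. destruct (i <? M)%nat; [apply Hz|].
    destruct (k <? n)%nat; [now left | now right]. }
  assert (H := Hh (n + n)%nat z' u' c' Hz').
  (* Among the four blocks, the two with equal last signs each give [h (t + 1)], since [s * s = 1],
     and the two with opposite signs each give [s * h (t - 1)]; hence the factor one half. *)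
  rewrite Csum2_app in H. apply (Cnonneg_scale (/ 2)) in H; [|lra].
  rewrite <- Csum_Cscale in H. erewrite Csum_ext; [exact H|].
  intros j Hj; cbv beta. rewrite <- Csum_Cscale. apply Csum_ext; intros l Hl; cbv beta.
  assert (E1 : forall k, (k < n)%nat -> (k <? n)%nat = true) by (intros; now apply Nat.ltb_lt).
  assert (E2 : forall k, ((n + k) <? n)%nat = false) by (intros; apply Nat.ltb_ge; lia).
  assert (E3 : forall k, (n + k - n = k)%nat) by (intros; lia).
  assert (Eu1 : forall k, (k < n)%nat -> u' k = u k) by (intros k Hk; unfold u'; now rewrite E1).
  assert (Eu2 : forall k, u' (n + k)%nat = u k) by (intros k; unfold u'; now rewrite E2, E3).
  assert (Ec1 : forall k, (k < n)%nat -> c' k = c k) by (intros k Hk; unfold c'; now rewrite E1).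
  assert (Ec2 : forall k, c' (n + k)%nat = Cscale s (c k)) by (intros k; unfold c'; now rewrite E2, E3).
  assert (Ez1 : forall k i, (k < n)%nat -> (i < M)%nat -> z' k i = z k i).
  { intros k i Hk Hi. unfold z'. apply Nat.ltb_lt in Hi. now rewrite Hi, E1. }
  assert (Ez2 : forall k i, (i < M)%nat -> z' (n + k)%nat i = z k i).
  { intros k i Hi. unfold z'. apply Nat.ltb_lt in Hi. now rewrite Hi, E2, E3. }
  assert (Ez3 : forall k, (k < n)%nat -> z' k M = 1).
  { intros k Hk. unfold z'. now rewrite Nat.ltb_irrefl, E1. }
  assert (Ez4 : forall k, z' (n + k)%nat M = -1).
  { intros k. unfold z'. now rewrite Nat.ltb_irrefl, E2. }
  rewrite !Eu1, !Eu2, !Ec1, !Ec2 by assumption. simpl dot.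
  rewrite !Ez3, !Ez4 by assumption.
  rewrite !(dot_ext M (z' j) _ (z j) (z l)), !(dot_ext M (z' (n + j)%nat) _ (z j) (z l))
    by (intros; split; first [now apply Ez1 | now apply Ez2]).
  replace (dot M (z j) (z l) + 1 * 1) with (dot M (z j) (z l) + 1) by ring.
  replace (dot M (z j) (z l) + 1 * -1) with (dot M (z j) (z l) - 1) by ring.
  replace (dot M (z j) (z l) + -1 * 1) with (dot M (z j) (z l) - 1) by ring.
  replace (dot M (z j) (z l) + -1 * -1) with (dot M (z j) (z l) + 1) by ring.
  set (A := h (dot M (z j) (z l) + 1) (gmul (ginv (u j)) (u l))).
  set (B := h (dot M (z j) (z l) - 1) (gmul (ginv (u j)) (u l))).
  assert (Hss : s * s = 1) by (destruct Hs; subst; ring).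
  clear - Hss.
  destruct A as [a1 a2], B as [b1 b2], (c j) as [p1 p2], (c l) as [q1 q2].
  apply Cpx_ext; simpl.
  - transitivity (/2 * (((a1 * p1 - a2 * p2) * q1 + (a1 * p2 + a2 * p1) * q2) * (1 + s * s)
      + 2 * s * ((b1 * p1 - b2 * p2) * q1 + (b1 * p2 + b2 * p1) * q2)));
      [rewrite Hss; field | field].
  - transitivity (/2 * ((- (a1 * p1 - a2 * p2) * q2 + (a1 * p2 + a2 * p1) * q1) * (1 + s * s)
      + 2 * s * (- (b1 * p1 - b2 * p2) * q2 + (b1 * p2 + b2 * p1) * q1)));
      [rewrite Hss; field | field].
Qed.

End CubePositivity.

(* [sign_coef N j g] is the coefficient of [x^j] in the Bernstein polynomial
   [E (g (e_1 + ... + e_N))], where the [e_i] in [{-1, 1}] are independent with mean [x]. *)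
Fixpoint sign_coef (N j : nat) (g : R -> R) : R :=
  match N with
  | O => match j with O => g 0 | S _ => 0 end
  | S M => / 2 * (sign_coef M j (fun t => g (t + 1) + g (t - 1)) +
                  match j with
                  | O => 0
                  | S i => sign_coef M i (fun t => g (t + 1) - g (t - 1))
                  end)
  end.

Definition Csign_coef (N j : nat) (g : R -> Cpx) : Cpx :=
  mkC (sign_coef N j (fun t => Cre (g t))) (sign_coef N j (fun t => Cim (g t))).

Lemma sign_coef_ext (N : nat) : forall (j : nat) (g h : R -> R),
  (forall t, g t = h t) -> sign_coef N j g = sign_coef N j h.
Proof.
  induction N as [|N IH]; intros j g h H; simpl.
  - destruct j; auto.
  - f_equal. f_equal; [apply IH; intro; now rewrite !H|].
    destruct j; [reflexivity | apply IH; intro; now rewrite !H].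
Qed.

(** Averaging over one sign of mean [x] gives [(g(t+1) + g(t-1))/2 + x (g(t+1) - g(t-1))/2]. Both
    combinations stay positive definite on the smaller cube, by [cube_pos_step] with [s = 1] and
    [s = -1]. *)
Lemma Csign_coef_pos_def (L : LCGroup) (N : nat) : forall (j : nat) (h : R -> L -> Cpx),
  cube_pos L N h ->
  pos_def_kernel L (fun u v => Csign_coef N j (fun t => h t (gmul (ginv u) v))).
Proof.
  induction N as [|N IH]; intros j h Hh.
  - destruct j as [|j].
    + intros n u c. apply (Hh n (fun _ _ => 1) u c). intros; now left.
    + intros n u c. unfold Csign_coef; simpl.
      erewrite Csum_ext; [|intros; apply (Csum_ext _ _ (fun _ => Cscale 0 C0)); intros;
                           apply Cpx_ext; simpl; ring].
      assert (E : Csum n (fun _ => Csum n (fun _ => Cscale 0 C0)) = Cscale 0 C0).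
      { erewrite Csum_ext; [|intros; apply Csum_Cscale]. rewrite Csum_Cscale.
        apply Cpx_ext; simpl; ring. }
      rewrite E. split; simpl; lra.
  - assert (Hp := cube_pos_step L N 1 h (or_introl eq_refl) Hh).
    assert (Hm := cube_pos_step L N (-1) h (or_intror eq_refl) Hh).
    destruct j as [|j].
    + eapply pos_def_kernel_ext; [|apply (pos_def_kernel_scale _ (/ 2));
                                   [lra | apply (IH 0%nat _ Hp)]].
      intros u v. apply Cpx_ext; simpl; rewrite Rplus_0_r; f_equal; apply sign_coef_ext; intro t; ring.
    + eapply pos_def_kernel_ext; [|apply (pos_def_kernel_scale _ (/ 2));
        [lra | apply pos_def_kernel_add; [apply (IH (S j) _ Hp) | apply (IH j _ Hm)]]].
      intros u v. apply Cpx_ext; simpl; f_equal; f_equal; apply sign_coef_ext; intro t; ring.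
Qed.

Lemma dot_dotp (d : nat) (z z' : nat -> R) (r : R) :
  dotp d (fun i => z i / r) (fun i => z' i / r) = dot (S d) z z' / (r * r).
Proof.
  unfold dotp. induction d as [|d IH].
  - simpl. unfold Rdiv. rewrite Rinv_mult. ring.
  - rewrite tech5, IH. simpl. unfold Rdiv. rewrite Rinv_mult. ring.
Qed.

Lemma dot_sign (N : nat) (z : nat -> R) : (forall i, is_sign (z i)) -> dot N z z = INR N.
Proof.
  intro H. induction N as [|N IH]; [reflexivity|].
  rewrite S_INR. simpl dot. rewrite IH. destruct (H N) as [-> | ->]; ring.
Qed.

Lemma in_P_S_cube_pos (L : LCGroup) (d : nat) (f : R -> L -> Cpx) :
  in_P_S L d f -> cube_pos L (S d) (fun t v => f (t / INR (S d)) v).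
Proof.
  intros [_ Hpd] n z u c Hz.
  assert (Hd : 0 < INR (S d)) by (apply lt_0_INR; lia).
  assert (Hr : sqrt (INR (S d)) * sqrt (INR (S d)) = INR (S d)) by (apply sqrt_sqrt; lra).
  assert (Hsph : forall k, on_sphere d (fun i => z k i / sqrt (INR (S d)))).
  { intro k. unfold on_sphere. rewrite dot_dotp, Hr, dot_sign by apply Hz.
    field. lra. }
  assert (H := Hpd n (fun k => (exist _ _ (Hsph k), u k)) c).
  erewrite Csum_ext; [exact H|]. intros j _; apply Csum_ext; intros l _; cbv beta.
  cbn [fst snd proj1_sig]. now rewrite dot_dotp, Hr.
Qed.

(** The kernel on the two points [e], [u] with weights 1 and [c]. The choice [c = 0] makes [phi(e)]
    real and nonnegative; [c = 1, -1, i, -i] force [phi(u^-1)] to be the conjugate of [phi(u)] and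
    bound the two components of [phi(u)]. *)
Lemma pos_def_bounds (L : LCGroup) (phi : L -> Cpx) (u : L) :
  pos_def_kernel L (fun u v => phi (gmul (ginv u) v)) ->
  Rabs (Cre (phi u)) <= Cre (phi gone) /\ Rabs (Cim (phi u)) <= Cre (phi gone) /\
  Cim (phi gone) = 0.
Proof.
  intro H.
  (* The axioms give the neutral element and inverses on the left only: the inverse of [e] is shown
     to be idempotent, and an idempotent equals [e]. *)
  assert (I1 : ginv (@gone L) = gone).
  { set (y := ginv (@gone L)).
    assert (H1 : gmul y y = y).
    { transitivity (gmul (gmul y gone) y).
      - now rewrite <- gmulA, gmul1l.
      - unfold y at 1. now rewrite gmulVl, gmul1l. }
    transitivity (gmul (gmul (ginv y) y) y).
    - now rewrite gmulVl, gmul1l.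
    - now rewrite <- gmulA, H1, gmulVl. }
  assert (E1 : gmul (ginv gone) (@gone L) = gone) by apply gmulVl.
  assert (E2 : gmul (ginv u) u = gone) by apply gmulVl.
  assert (E3 : gmul (ginv gone) u = u) by (rewrite I1; apply gmul1l).
  assert (K : forall c : Cpx, Cnonneg (Csum 2 (fun j => Csum 2 (fun l =>
       Cmul (Cmul (phi (gmul (ginv (match j with O => gone | _ => u end))
              (match l with O => gone | _ => u end)))
         (match j with O => mkC 1 0 | _ => c end)) (Cconj (match l with O => mkC 1 0 | _ => c end)))))).
  { intro c. apply (H 2%nat (fun j => match j with O => gone | _ => u end)
                      (fun j => match j with O => mkC 1 0 | _ => c end)). }
  assert (K0 := K (mkC 0 0)). assert (K1 := K (mkC 1 0)). assert (K2 := K (mkC (-1) 0)).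
  assert (K3 := K (mkC 0 1)). assert (K4 := K (mkC 0 (-1))).
  unfold Cnonneg in *; simpl in *. rewrite E1, E2, E3 in *. clear - K0 K1 K2 K3 K4.
  set (w := gmul (ginv u) gone) in *.
  repeat split; try apply Rabs_le; lra.
Qed.

(** Conditioning on one sign, which is 1 with probability [(1+x)/2] and -1 with probability
    [(1-x)/2]. *)
Fixpoint bernstein (N : nat) (x : R) (g : R -> R) : R :=
  match N with
  | O => g 0
  | S M => (1 + x) / 2 * bernstein M x (fun t => g (t + 1)) + (1 - x) / 2 * bernstein M x (fun t => g (t - 1))
  end.

(** * Bernstein polynomials *)

Lemma sign_coef_add (N : nat) : forall (j : nat) (g h : R -> R),
  sign_coef N j (fun t => g t + h t) = sign_coef N j g + sign_coef N j h.
Proof.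
  induction N as [|N IH]; intros j g h; simpl.
  - destruct j; ring.
  - rewrite (sign_coef_ext N j _ (fun t => (g (t + 1) + g (t - 1)) + (h (t + 1) + h (t - 1))))
      by (intro; ring).
    rewrite (IH j (fun t => g (t + 1) + g (t - 1))). destruct j as [|j]; [ring|].
    rewrite (sign_coef_ext N j _ (fun t => (g (t + 1) - g (t - 1)) + (h (t + 1) - h (t - 1))))
      by (intro; ring).
    rewrite (IH j (fun t => g (t + 1) - g (t - 1))). ring.
Qed.

Lemma sign_coef_scal (N : nat) : forall (j : nat) (c : R) (g : R -> R),
  sign_coef N j (fun t => c * g t) = c * sign_coef N j g.
Proof.
  induction N as [|N IH]; intros j c g; simpl.
  - destruct j; ring.
  - rewrite (sign_coef_ext N j _ (fun t => c * (g (t + 1) + g (t - 1)))) by (intro; ring).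
    rewrite IH. destruct j as [|j]; [ring|].
    rewrite (sign_coef_ext N j _ (fun t => c * (g (t + 1) - g (t - 1)))) by (intro; ring).
    rewrite IH. ring.
Qed.

Lemma sign_coef_gt (N : nat) : forall (j : nat) (g : R -> R), (N < j)%nat -> sign_coef N j g = 0.
Proof.
  induction N as [|N IH]; intros j g Hj; (destruct j as [|j]; [lia|]); simpl; [reflexivity|].
  rewrite !IH by lia. ring.
Qed.

Lemma bernstein_psum (N : nat) : forall (x : R) (g : R -> R),
  bernstein N x g = poly_sum (fun j => sign_coef N j g) N x.
Proof.
  induction N as [|N IH]; intros x g.
  - unfold poly_sum; simpl. ring.
  - simpl bernstein. rewrite !IH.
    set (p := fun t => g (t + 1)). set (q := fun t => g (t - 1)).
    assert (Hp : forall j, sign_coef N j (fun t => g (t + 1) + g (t - 1)) = sign_coef N j p + sign_coef N j q)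
      by (intro; apply (sign_coef_add N j p q)).
    assert (Hm : forall j, sign_coef N j (fun t => g (t + 1) - g (t - 1)) = sign_coef N j p + -1 * sign_coef N j q).
    { intro. rewrite <- sign_coef_scal, <- sign_coef_add. apply sign_coef_ext. intro; unfold p, q; ring. }
    unfold poly_sum at 3. rewrite decomp_sum by lia. simpl pred.
    (* The upper index [M] is free so that it can be inducted on while [N] stays fixed. At [M = N]
       the coefficients of index [N + 1] of [p] and [q] vanish. *)
    assert (E : forall M, sum_f_R0 (fun i => sign_coef (S N) (S i) g * x ^ S i) M =
      / 2 * (poly_sum (fun j => sign_coef N j p) (S M) x - sign_coef N 0 p +
             (poly_sum (fun j => sign_coef N j q) (S M) x - sign_coef N 0 q)) +
      / 2 * x * (poly_sum (fun j => sign_coef N j p) M x - poly_sum (fun j => sign_coef N j q) M x)).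
    { unfold poly_sum. induction M as [|M IHM].
      - simpl. rewrite Hp, Hm. ring.
      - rewrite tech5, IHM, !tech5. simpl sign_coef. rewrite Hp, Hm. simpl pow. field. }
    rewrite E. unfold poly_sum. rewrite !tech5, (sign_coef_gt N (S N) p), (sign_coef_gt N (S N) q) by lia.
    simpl sign_coef. rewrite Hp. simpl pow. field.
Qed.

Lemma bernstein_le (N : nat) : forall (x : R) (g h : R -> R),
  -1 <= x <= 1 -> (forall t, - INR N <= t <= INR N -> g t <= h t) -> bernstein N x g <= bernstein N x h.
Proof.
  induction N as [|N IH]; intros x g h Hx H.
  - simpl. apply H. simpl; lra.
  - rewrite S_INR in H. simpl bernstein. apply Rplus_le_compat; apply Rmult_le_compat_l; try lra;
      apply IH; try exact Hx; intros t Ht; apply H; lra.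
Qed.

Lemma bernstein_lin (N : nat) : forall (x a b : R) (g : R -> R),
  bernstein N x (fun t => a * g t + b) = a * bernstein N x g + b.
Proof.
  induction N as [|N IH]; intros; simpl; [ring|]. rewrite !IH. field.
Qed.

(** Squared bias plus variance: each of the [N] independent signs has variance [1 - x^2]. The centre
    [y] is arbitrary because the induction shifts it by 1 and -1. *)
Lemma bernstein_sq (N : nat) : forall (x y : R),
  bernstein N x (fun t => (t - y) ^ 2) = (INR N * x - y) ^ 2 + INR N * (1 - x ^ 2).
Proof.
  induction N as [|N IH]; intros x y.
  - simpl. ring.
  - rewrite S_INR. simpl bernstein.
    assert (E1 : bernstein N x (fun t => (t + 1 - y) * ((t + 1 - y) * 1)) =
                 bernstein N x (fun t => (t - (y - 1)) ^ 2)).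
    { f_equal. apply FunctionalExtensionality.functional_extensionality; intro; ring. }
    assert (E2 : bernstein N x (fun t => (t - 1 - y) * ((t - 1 - y) * 1)) =
                 bernstein N x (fun t => (t - (y + 1)) ^ 2)).
    { f_equal. apply FunctionalExtensionality.functional_extensionality; intro; ring. }
    rewrite E1, E2, !IH. field.
Qed.

(** The Chebyshev argument: the deviation of [F(t/N)] from [F(x)] is at most [eps/2] plus a multiple
    of [(t - N x)^2 / N^2], whose mean is of order [1/N]. *)
Lemma bernstein_cvg (F : R -> R) (x : R) :
  cont_on_I F -> -1 <= x <= 1 ->
  is_lim_seq (fun i => bernstein (S (S i)) x (fun t => F (t / INR (S (S i))))) (F x).
Proof.
  intros HF Hx.
  destruct (bounded_continuity (V := R_NormedModule) (fun y => F (clamp y)) (-1) 1) as [B HB].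
  { intros y _. now apply continuous_clamp. }
  assert (HB' : forall y, -1 <= y <= 1 -> Rabs (F y) < B).
  { intros y Hy. specialize (HB y Hy). now rewrite clamp_id in HB by exact Hy. }
  assert (HB0 : 0 < B) by (eapply Rle_lt_trans; [apply Rabs_pos | apply (HB' x Hx)]).
  apply is_lim_seq_spec. intros [eps Heps]. cbn [pos].
  destruct (HF x (eps / 2) Hx ltac:(lra)) as [delta [Hdel Hcont]].
  (* Chosen so that [c (y - x)^2] reaches the trivial bound [2 B] as soon as [|y - x| >= delta]. *)
  set (c := 2 * B / (delta * delta)).
  assert (Hc : 0 < c) by (unfold c; apply Rdiv_lt_0_compat; nra).
  destruct (nfloor_ex (2 * c / eps)) as [N0 [_ HN0]]; [apply Rlt_le, Rdiv_lt_0_compat; lra|].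
  exists N0. intros i Hi. set (N := S (S i)).
  assert (HN : INR N0 + 1 <= INR N) by (rewrite <- S_INR; apply le_INR; unfold N; lia).
  assert (HN1 : 0 < INR N) by (pose proof (pos_INR N0); lra).
  assert (Hpt : forall t, - INR N <= t <= INR N ->
            Rabs (F (t / INR N) - F x) <= eps / 2 + c / (INR N * INR N) * (t - INR N * x) ^ 2).
  { intros t Ht. set (y := t / INR N).
    assert (Et : t = INR N * y) by (unfold y; field; lra).
    assert (Hy : -1 <= y <= 1).
    { unfold y; split; [apply (Rmult_le_reg_r (INR N)) | apply (Rmult_le_reg_r (INR N))];
        try exact HN1; unfold Rdiv; rewrite Rmult_assoc, Rinv_l by lra; lra. }
    replace (c / (INR N * INR N) * (t - INR N * x) ^ 2) with (c * (y - x) ^ 2)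
      by (rewrite Et; field; lra).
    assert (Hsq := pow2_ge_0 (y - x)).
    destruct (Rlt_or_le (Rabs (y - x)) delta) as [Hlt | Hge].
    - assert (H := Hcont y Hy Hlt). assert (0 <= c * (y - x) ^ 2) by (apply Rmult_le_pos; lra). lra.
    - assert (H1 := HB' y Hy). assert (H2 := HB' x Hx).
      assert (H3 : Rabs (F y - F x) <= 2 * B).
      { unfold Rminus. eapply Rle_trans; [apply Rabs_triang|]. rewrite Rabs_Ropp. lra. }
      assert (H4 : 2 * B <= c * (y - x) ^ 2); [|lra].
      replace (2 * B) with (c * (delta * delta)) by (unfold c; field; lra).
      apply Rmult_le_compat_l; [lra|]. rewrite <- (pow2_abs (y - x)). simpl. rewrite Rmult_1_r.
      apply Rmult_le_compat; lra. }
  set (q := fun t => (t - INR N * x) ^ 2).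
  assert (Hq : bernstein N x q <= INR N).
  { unfold q. rewrite bernstein_sq, Rminus_diag. pose proof (pow2_ge_0 x). nra. }
  assert (Hlast : c / (INR N * INR N) * bernstein N x q < eps / 2).
  { apply Rle_lt_trans with (c / (INR N * INR N) * INR N).
    - apply Rmult_le_compat_l; [|exact Hq]. apply Rlt_le, Rdiv_lt_0_compat; nra.
    - replace (c / (INR N * INR N) * INR N) with (c / INR N) by (field; lra).
      apply (Rmult_lt_reg_r (INR N)); [exact HN1|].
      unfold Rdiv at 1. rewrite Rmult_assoc, Rinv_l, Rmult_1_r by lra.
      apply (Rmult_lt_reg_l (2 / eps)); [apply Rdiv_lt_0_compat; lra|].
      replace (2 / eps * c) with (2 * c / eps) by (field; lra).
      replace (2 / eps * (eps / 2 * INR N)) with (INR N) by (field; lra). lra. }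
  assert (Hup := bernstein_le N x (fun t => F (t / INR N))
                   (fun t => c / (INR N * INR N) * q t + (F x + eps / 2)) Hx).
  assert (Hlo := bernstein_le N x (fun t => - (c / (INR N * INR N)) * q t + (F x - eps / 2))
                   (fun t => F (t / INR N)) Hx).
  rewrite bernstein_lin in Hup. rewrite bernstein_lin in Hlo.
  assert (Hup' := Hup (fun t Ht => ltac:(specialize (Hpt t Ht); apply Rabs_le_between in Hpt; unfold q; lra))).
  assert (Hlo' := Hlo (fun t Ht => ltac:(specialize (Hpt t Ht); apply Rabs_le_between in Hpt; unfold q; lra))).
  rewrite Ropp_mult_distr_l_reverse in Hlo'.
  set (w := c / (INR N * INR N) * bernstein N x q) in *.
  apply Rabs_lt_between. split; lra.
Qed.

(** * Coefficients of convergent polynomials with bounded coefficient sums *)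

Lemma pow_antitone (x : R) (m n : nat) : 0 <= x <= 1 -> (m <= n)%nat -> x ^ n <= x ^ m.
Proof.
  intros Hx Hmn. induction Hmn as [|n Hmn IH]; [lra|]. simpl.
  assert (0 <= x ^ n) by (apply pow_le; lra). nra.
Qed.

(** Serves two purposes: the power of [|x|] isolates single coefficients at small [x], and the
    majorant [b] gives estimates uniform up to [|x| = 1]. *)
Lemma poly_sum_tail (a b : nat -> R) (m N : nat) (x : R) :
  (m <= N)%nat -> Rabs x <= 1 -> (forall k, Rabs (a k) <= b k) ->
  Rabs (poly_sum a N x - poly_sum a m x) <= Rabs x ^ S m * (sum_f_R0 b N - sum_f_R0 b m).
Proof.
  intros HmN Hx Hb. unfold poly_sum. induction HmN as [|N HmN IH].
  - rewrite !Rminus_diag, Rabs_R0. lra.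
  - rewrite !tech5.
    replace (sum_f_R0 (fun k => a k * x ^ k) N + a (S N) * x ^ S N - sum_f_R0 (fun k => a k * x ^ k) m)
      with ((sum_f_R0 (fun k => a k * x ^ k) N - sum_f_R0 (fun k => a k * x ^ k) m)
            + a (S N) * x ^ S N) by ring.
    eapply Rle_trans; [apply Rabs_triang|].
    replace (Rabs x ^ S m * (sum_f_R0 b N + b (S N) - sum_f_R0 b m)) with
      (Rabs x ^ S m * (sum_f_R0 b N - sum_f_R0 b m) + b (S N) * Rabs x ^ S m) by ring.
    apply Rplus_le_compat; [exact IH|]. rewrite Rabs_mult, <- RPow_abs.
    apply Rmult_le_compat; try apply Rabs_pos; [apply pow_le, Rabs_pos | apply Hb |].
    apply pow_antitone; [split; [apply Rabs_pos | exact Hx] | lia].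
Qed.

Lemma poly_sum_tail_sum (a : nat -> R) (M : R) (m N : nat) (x : R) :
  (m <= N)%nat -> Rabs x <= 1 -> sum_f_R0 (fun k => Rabs (a k)) N <= M ->
  Rabs (poly_sum a N x - poly_sum a m x) <= M * Rabs x ^ S m.
Proof.
  intros HmN Hx HM. eapply Rle_trans; [apply poly_sum_tail; [exact HmN | exact Hx | intro; apply Rle_refl]|].
  rewrite Rmult_comm. apply Rmult_le_compat_r; [apply pow_le, Rabs_pos|].
  assert (0 <= sum_f_R0 (fun k => Rabs (a k)) m) by (apply cond_pos_sum; intro; apply Rabs_pos). lra.
Qed.

Section CoefficientLimit.
Variables (a : nat -> nat -> R) (F : R -> R) (M : R).
Hypothesis a_sum : forall i, sum_f_R0 (fun k => Rabs (a i k)) (S (S i)) <= M.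
Hypothesis a_cvg : forall x, -1 <= x <= 1 -> is_lim_seq (fun i => poly_sum (a i) (S (S i)) x) (F x).

Lemma poly_sum_seq_lim (al : nat -> R) (m : nat) (x : R) :
  (forall j, (j <= m)%nat -> is_lim_seq (fun i => a i j) (al j)) ->
  is_lim_seq (fun i => poly_sum (a i) m x) (poly_sum al m x).
Proof.
  intro H. unfold poly_sum. induction m as [|m IH].
  - simpl. apply is_lim_seq_mult'; [now apply H | apply is_lim_seq_const].
  - apply (is_lim_seq_ext (fun i => sum_f_R0 (fun k => a i k * x ^ k) m + a i (S m) * x ^ S m));
      [intro; now rewrite tech5|].
    rewrite tech5. apply is_lim_seq_plus'; [apply IH; intros; apply H; lia|].
    apply is_lim_seq_mult'; [now apply H | apply is_lim_seq_const].
Qed.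

(** Induction on the index. Once the coefficients up to [m] converge, [F x] minus their limiting
    polynomial, divided by [x^(m+1)], approximates [a i (m+1)] for large [i] up to about [M x]. A
    small fixed [x] thus makes the sequence Cauchy. *)
Lemma coefficient_ex_lim (j : nat) : ex_finite_lim_seq (fun i => a i j).
Proof.
  enough (H : forall k, (k <= j)%nat -> ex_finite_lim_seq (fun i => a i k)) by now apply H.
  assert (M0 : 0 <= M).
  { eapply Rle_trans; [|apply (a_sum 0)]. apply cond_pos_sum. intro; apply Rabs_pos. }
  induction j as [|m IH]; intros k Hk.
  - assert (k = 0)%nat by lia; subst k. exists (F 0).
    apply (is_lim_seq_ext (fun i => poly_sum (a i) (S (S i)) 0)); [|apply a_cvg; lra].
    intro i. assert (H := poly_sum_tail_sum (a i) M 0 (S (S i)) 0 ltac:(lia)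
                            ltac:(rewrite Rabs_R0; lra) (a_sum i)).
    rewrite Rabs_R0, pow_ne_zero, Rmult_0_r in H by lia.
    unfold poly_sum in H at 2. simpl in H.
    assert (H0 := Rabs_pos (poly_sum (a i) (S (S i)) 0 - a i 0%nat * 1)).
    assert (H1 : poly_sum (a i) (S (S i)) 0 - a i 0%nat * 1 = 0)
      by (apply Rabs_eq_0; lra). lra.
  - destruct (Nat.le_gt_cases k m) as [Hle | Hgt]; [now apply IH|].
    assert (k = S m) by lia; subst k. clear Hk Hgt.
    assert (Hal : exists al : nat -> R, forall j, (j <= m)%nat -> is_lim_seq (fun i => a i j) (al j)).
    { exists (fun j => real (Lim_seq (fun i => a i j))). intros j' Hj.
      now apply Lim_seq_correct', IH. }
    destruct Hal as [al Hal].
    apply ex_lim_seq_cauchy_corr. intros [eps Heps]. simpl.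
    (* Makes [M x] at most [eps/4]; dividing by [M + 1] covers the case [M = 0]. *)
    set (x := Rmin 1 (eps / (4 * (M + 1)))).
    assert (Hx0 : 0 < x) by (unfold x; apply Rmin_glb_lt; [lra | apply Rdiv_lt_0_compat; lra]).
    assert (Hx1 : x <= 1) by apply Rmin_l.
    assert (Hx2 : M * x < eps / 4 + eps / 8).
    { apply Rle_lt_trans with (eps / 4); [|lra].
      apply Rle_trans with ((M + 1) * (eps / (4 * (M + 1)))); [|right; field; lra].
      apply Rmult_le_compat; try lra. apply Rmin_r. }
    assert (Hxp : 0 < x ^ S m) by now apply pow_lt.
    assert (Hdiff := is_lim_seq_minus' _ _ _ _ (a_cvg x ltac:(lra)) (poly_sum_seq_lim al m x Hal)).
    apply is_lim_seq_spec in Hdiff. 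
    assert (He : 0 < eps / 8 * x ^ S m) by (apply Rmult_lt_0_compat; lra).
    destruct (Hdiff (mkposreal _ He)) as [N0 HN0]. simpl in HN0.
    (* Error budget relative to [x^(m+1)]: less than [3 eps/8] from the terms beyond degree [m+1],
       and [eps/8] from the convergence at [x]. Requiring [i >= m] makes the degree [i + 2] exceed
       [m + 1]. *)
    assert (Key : forall i, (N0 + m <= i)%nat ->
              Rabs (a i (S m) * x ^ S m - (F x - poly_sum al m x)) < eps / 2 * x ^ S m).
    { intros i Hi. specialize (HN0 i ltac:(lia)).
      assert (H := poly_sum_tail_sum (a i) M (S m) (S (S i)) x ltac:(lia)
                     ltac:(rewrite Rabs_pos_eq; lra) (a_sum i)).
      assert (E : poly_sum (a i) (S m) x = poly_sum (a i) m x + a i (S m) * x ^ S m)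
        by (unfold poly_sum; apply tech5).
      rewrite E, (Rabs_pos_eq x) in H by lra.
      replace (M * x ^ S (S m)) with ((M * x) * x ^ S m) in H by (simpl; ring).
      assert (H' : (M * x) * x ^ S m < (eps / 4 + eps / 8) * x ^ S m)
        by now apply Rmult_lt_compat_r.
      apply Rabs_le_between in H. apply Rabs_lt_between in HN0. apply Rabs_lt_between.
      change (x * x ^ m) with (x ^ S m) in HN0. lra. }
    exists (N0 + m)%nat. intros p q Hp Hq. apply Key in Hp, Hq.
    apply (Rmult_lt_reg_r (x ^ S m)); [exact Hxp|].
    rewrite <- (Rabs_pos_eq (x ^ S m)) at 1 by lra. rewrite <- Rabs_mult.
    apply Rabs_lt_between in Hp. apply Rabs_lt_between in Hq. apply Rabs_lt_between. lra.
Qed.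

Definition limcoef (j : nat) : R := real (Lim_seq (fun i => a i j)).

Lemma limcoef_correct (j : nat) : is_lim_seq (fun i => a i j) (limcoef j).
Proof. apply Lim_seq_correct', coefficient_ex_lim. Qed.

(** The tail estimate with [m] and [x] fixed, passed to the limit in [i]; [M] is the same for all
    [m]. *)
Lemma limcoef_remainder (m : nat) (x : R) :
  -1 <= x <= 1 -> Rabs (F x - poly_sum limcoef m x) <= M * Rabs x ^ S m.
Proof.
  intro Hx.
  assert (H := is_lim_seq_abs _ _ (is_lim_seq_minus' _ _ _ _ (a_cvg x Hx)
                 (poly_sum_seq_lim limcoef m x (fun j _ => limcoef_correct j)))).
  simpl in H.
  refine (is_lim_seq_le_loc _ (fun _ => M * Rabs x ^ S m) _ _ _ H (is_lim_seq_const _)).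
  exists m. intros i Hi.
  apply poly_sum_tail_sum; [lia | now apply Rabs_le | apply a_sum].
Qed.

End CoefficientLimit.

(** For [|x| < 1] the remainder [M |x|^(n+1)] tends to 0, so only the tail of [be] is left. At the
    endpoints the remainder is useless, and the bound is extended by continuity of [F] and of the
    polynomial. *)
Lemma poly_sum_uniform (F : R -> R) (al be : nat -> R) (M eps : R) (m : nat) :
  cont_on_I F ->
  (forall k, Rabs (al k) <= be k) ->
  (forall n x, -1 <= x <= 1 -> Rabs (F x - poly_sum al n x) <= M * Rabs x ^ S n) ->
  (forall n, (m <= n)%nat -> sum_f_R0 be n - sum_f_R0 be m <= eps) ->
  forall x, -1 <= x <= 1 -> Rabs (poly_sum al m x - F x) <= eps.
Proof.
  intros HF Hal Hrem Htail.
  assert (Hint : forall x, -1 < x < 1 -> Rabs (poly_sum al m x - F x) <= eps).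
  { intros x Hx. assert (Hx' : Rabs x < 1) by (apply Rabs_lt_between; lra).
    assert (HG : is_lim_seq (fun n => eps + M * (Rabs x * Rabs x ^ n)) eps).
    { replace (Finite eps) with (Finite (eps + M * (Rabs x * 0))) by (f_equal; ring).
      apply is_lim_seq_plus'; [apply is_lim_seq_const|].
      do 2 (apply is_lim_seq_mult'; [apply is_lim_seq_const|]).
      apply is_lim_seq_geom. now rewrite Rabs_Rabsolu. }
    refine (is_lim_seq_le_loc (fun _ => Rabs (poly_sum al m x - F x)) _ _ _ _ (is_lim_seq_const _) HG).
    exists m. intros n Hn.
    assert (H1 := Hrem n x ltac:(lra)).
    assert (H2 := poly_sum_tail al be m n x Hn ltac:(lra) Hal).
    assert (H3 := Htail n Hn).
    assert (H4 : 0 <= sum_f_R0 be n - sum_f_R0 be m).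
    { clear - Hn Hal. induction Hn as [|n Hn IH]; [lra|]. rewrite tech5.
      assert (H := Hal (S n)). pose proof (Rabs_pos (al (S n))). lra. }
    assert (H5 : Rabs x ^ S m <= 1).
    { rewrite <- (pow1 (S m)). apply pow_incr. split; [apply Rabs_pos | lra]. }
    assert (H6 : 0 <= Rabs x ^ S m) by apply pow_le, Rabs_pos.
    assert (H7 : Rabs (poly_sum al n x - poly_sum al m x) <= eps) by nra.
    change (Rabs x * Rabs x ^ n) with (Rabs x ^ S n).
    apply Rabs_le_between in H1. apply Rabs_le_between in H7. apply Rabs_le_between. lra. }
  intros x Hx. apply le_epsilon. intros eta Heta.
  assert (Hc : continuity_pt (poly_sum al m) x) by (apply continuity_pt_filterlim, continuous_psum).
  destruct (Hc (eta / 2) ltac:(lra)) as [d1 [Hd1 H1]].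
  destruct (HF x (eta / 2) Hx ltac:(lra)) as [d2 [Hd2 H2]].
  set (d := Rmin (1 / 2) (Rmin d1 d2 / 2)).
  assert (Hd0 : 0 < d) by (unfold d; repeat apply Rmin_glb_lt; try lra;
                            apply Rdiv_lt_0_compat; [apply Rmin_glb_lt; lra | lra]).
  assert (Hdh : d <= 1 / 2) by apply Rmin_l.
  assert (Hdm : d < Rmin d1 d2).
  { apply Rle_lt_trans with (Rmin d1 d2 / 2); [apply Rmin_r|].
    assert (0 < Rmin d1 d2) by (apply Rmin_glb_lt; lra). lra. }
  assert (Hdd1 := Rmin_l d1 d2). assert (Hdd2 := Rmin_r d1 d2).
  (* Moving from [x] towards or across 0 by at most 1/2 stays in the open interval. The condition
     [y <> x] is needed because [continuity_pt] speaks of punctured neighbourhoods. *)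
  assert (Hy : exists y, -1 < y < 1 /\ y <> x /\ Rabs (y - x) <= d).
  { destruct (Rle_lt_dec 0 x).
    - exists (x - d). repeat split; try lra. apply Rabs_le; lra.
    - exists (x + d). repeat split; try lra. apply Rabs_le; lra. }
  destruct Hy as [y [Hy [Hyx Hyd]]].
  assert (K1 := H1 y). simpl in K1. unfold R_dist in K1.
  assert (K1' : Rabs (poly_sum al m y - poly_sum al m x) < eta / 2).
  { apply K1. split; [split; [exact I | intro; now apply Hyx] | lra]. }
  assert (K2 := H2 y ltac:(lra) ltac:(lra)).
  assert (K3 := Hint y Hy).
  apply Rabs_lt_between in K1'. apply Rabs_lt_between in K2.
  apply Rabs_le_between in K3. apply Rabs_le_between. lra.
Qed.

(** * The limit expansion on the group *)

Lemma Cnorm_ge (z : Cpx) : Rabs (Cre z) <= Cnorm z /\ Rabs (Cim z) <= Cnorm z.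
Proof.
  unfold Cnorm. assert (H1 := pow2_ge_0 (Cre z)). assert (H2 := pow2_ge_0 (Cim z)).
  rewrite <- (sqrt_pow2 (Rabs (Cre z))), <- (sqrt_pow2 (Rabs (Cim z))), !pow2_abs by apply Rabs_pos.
  split; apply sqrt_le_1_alt; lra.
Qed.

Lemma Cnorm_le (z : Cpx) : Cnorm z <= Rabs (Cre z) + Rabs (Cim z).
Proof.
  unfold Cnorm. assert (H1 := Rabs_pos (Cre z)). assert (H2 := Rabs_pos (Cim z)).
  rewrite <- (sqrt_pow2 (Rabs (Cre z) + Rabs (Cim z))) by lra.
  apply sqrt_le_1_alt. rewrite <- (pow2_abs (Cre z)), <- (pow2_abs (Cim z)). nra.
Qed.

Definition is_lim_Cseq (z : nat -> Cpx) (w : Cpx) : Prop :=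
  is_lim_seq (fun i => Cre (z i)) (Cre w) /\ is_lim_seq (fun i => Cim (z i)) (Cim w).

Lemma is_lim_Cseq_const (w : Cpx) : is_lim_Cseq (fun _ => w) w.
Proof. split; apply is_lim_seq_const. Qed.

Lemma is_lim_Cseq_add (z1 z2 : nat -> Cpx) (w1 w2 : Cpx) :
  is_lim_Cseq z1 w1 -> is_lim_Cseq z2 w2 -> is_lim_Cseq (fun i => Cadd (z1 i) (z2 i)) (Cadd w1 w2).
Proof. intros [? ?] [? ?]; split; simpl; now apply is_lim_seq_plus'. Qed.

Lemma is_lim_Cseq_mul (z1 z2 : nat -> Cpx) (w1 w2 : Cpx) :
  is_lim_Cseq z1 w1 -> is_lim_Cseq z2 w2 -> is_lim_Cseq (fun i => Cmul (z1 i) (z2 i)) (Cmul w1 w2).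
Proof.
  intros [? ?] [? ?]; split; simpl;
    [apply is_lim_seq_minus' | apply is_lim_seq_plus']; now apply is_lim_seq_mult'.
Qed.

Lemma is_lim_Cseq_sum (n : nat) (z : nat -> nat -> Cpx) (w : nat -> Cpx) :
  (forall k, is_lim_Cseq (fun i => z i k) (w k)) -> is_lim_Cseq (fun i => Csum n (z i)) (Csum n w).
Proof.
  intro H. induction n as [|n IH]; simpl; [apply is_lim_Cseq_const | now apply is_lim_Cseq_add].
Qed.

Lemma pos_def_kernel_lim (X : Type) (k : nat -> X -> X -> Cpx) (k' : X -> X -> Cpx) :
  (forall i, pos_def_kernel X (k i)) ->
  (forall x y, is_lim_Cseq (fun i => k i x y) (k' x y)) -> pos_def_kernel X k'.
Proof.
  intros H Hk n x c.
  assert (Hl : is_lim_Cseq (fun i => Csum n (fun j => Csum n (fun l =>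
                 Cmul (Cmul (k i (x j) (x l)) (c j)) (Cconj (c l)))))
               (Csum n (fun j => Csum n (fun l =>
                 Cmul (Cmul (k' (x j) (x l)) (c j)) (Cconj (c l)))))).
  { apply is_lim_Cseq_sum. intro j. apply is_lim_Cseq_sum. intro l.
    apply is_lim_Cseq_mul; [apply is_lim_Cseq_mul; [apply Hk|]|]; apply is_lim_Cseq_const. }
  destruct Hl as [Hre Him]. split.
  - apply is_lim_seq_unique in Him.
    rewrite (Lim_seq_ext _ (fun _ => 0)) in Him by (intro i; apply (H i n x c)).
    rewrite Lim_seq_const in Him. now injection Him.
  - refine (is_lim_seq_le (fun _ => 0) _ 0 _ _ (is_lim_seq_const 0) Hre).
    intro i. apply (H i n x c).
Qed.

Definition continuous_LR (L : LCGroup) (h : L -> R) : Prop :=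
  forall u eps, 0 < eps -> exists U, gopen L U /\ U u /\
    forall v, U v -> Rabs (h v - h u) < eps.

Lemma continuous_LR_plus (L : LCGroup) (g h : L -> R) :
  continuous_LR L g -> continuous_LR L h -> continuous_LR L (fun v => g v + h v).
Proof.
  intros Hg Hh u eps Heps.
  destruct (Hg u (eps / 2) ltac:(lra)) as [U [HU [HUu HUv]]].
  destruct (Hh u (eps / 2) ltac:(lra)) as [V [HV [HVu HVv]]].
  exists (fun x => U x /\ V x). split; [now apply gopen_inter|]. split; [now split|].
  intros v [Hv1 Hv2]. specialize (HUv v Hv1). specialize (HVv v Hv2).
  apply Rabs_lt_between in HUv. apply Rabs_lt_between in HVv. apply Rabs_lt_between. lra.
Qed.

Lemma continuous_LR_scal (L : LCGroup) (c : R) (h : L -> R) :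
  continuous_LR L h -> continuous_LR L (fun v => h v * c).
Proof.
  intros Hh u eps Heps.
  assert (Hc : 0 < Rabs c + 1) by (pose proof (Rabs_pos c); lra).
  destruct (Hh u (eps / (Rabs c + 1))) as [U [HU [HUu HUv]]]; [now apply Rdiv_lt_0_compat|].
  exists U. split; [exact HU|]. split; [exact HUu|]. intros v Hv. specialize (HUv v Hv).
  replace (h v * c - h u * c) with ((h v - h u) * c) by ring. rewrite Rabs_mult.
  apply Rle_lt_trans with (Rabs (h v - h u) * (Rabs c + 1)).
  - apply Rmult_le_compat_l; [apply Rabs_pos | lra].
  - apply (Rmult_lt_compat_r (Rabs c + 1)) in HUv; [|exact Hc].
    replace (eps / (Rabs c + 1) * (Rabs c + 1)) with eps in HUv by (field; lra). exact HUv.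
Qed.

Lemma continuous_LR_unif (L : LCGroup) (h : L -> R) :
  (forall eps, 0 < eps -> exists g, continuous_LR L g /\ forall v, Rabs (h v - g v) <= eps) ->
  continuous_LR L h.
Proof.
  intros H u eps Heps.
  destruct (H (eps / 4) ltac:(lra)) as [g [Hg Hgh]].
  destruct (Hg u (eps / 4) ltac:(lra)) as [U [HU [HUu HUv]]].
  exists U. split; [exact HU|]. split; [exact HUu|]. intros v Hv. specialize (HUv v Hv).
  assert (H1 := Hgh v). assert (H2 := Hgh u).
  apply Rabs_le_between in H1. apply Rabs_le_between in H2. apply Rabs_lt_between in HUv.
  apply Rabs_lt_between. lra.
Qed.

Lemma continuous_LR_psum (L : LCGroup) (al : L -> nat -> R) (m : nat) (x : R) :
  (forall j, (j <= m)%nat -> continuous_LR L (fun u => al u j)) -> continuous_LR L (fun u => poly_sum (al u) m x).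
Proof.
  intro H. unfold poly_sum. induction m as [|m IH]; simpl sum_f_R0.
  - apply continuous_LR_scal. now apply H.
  - apply continuous_LR_plus; [apply IH; intros; apply H; lia|].
    apply (continuous_LR_scal L (x ^ S m) (fun u => al u (S m))). now apply H.
Qed.

(** By induction, [(F u x - lower terms) / x^(m+1)] is continuous in [u], and it differs from
    [al u (m+1)] by at most [M x] for all [u] at once. The coefficient is thus a uniform limit of
    continuous functions. *)
Lemma continuous_LR_coefficient (L : LCGroup) (F : L -> R -> R) (al : L -> nat -> R) (M : R) (j : nat) :
  (forall x, -1 <= x <= 1 -> continuous_LR L (fun u => F u x)) ->
  (forall u m x, -1 <= x <= 1 -> Rabs (F u x - poly_sum (al u) m x) <= M * Rabs x ^ S m) ->
  continuous_LR L (fun u => al u j).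
Proof.
  intros HF Hrem.
  enough (H : forall k, (k <= j)%nat -> continuous_LR L (fun u => al u k)) by now apply H.
  induction j as [|m IH]; intros k Hk; apply continuous_LR_unif; intros eps Heps.
  - assert (k = 0)%nat by lia; subst k.
    exists (fun u => F u 0). split; [apply HF; lra|]. intro v.
    assert (H := Hrem v 0%nat 0 ltac:(lra)). unfold poly_sum in H; simpl in H.
    rewrite Rabs_R0, Rmult_0_l, Rmult_0_r, Rmult_1_r in H.
    rewrite Rabs_minus_sym. lra.
  - destruct (Nat.le_gt_cases k m) as [Hle | Hgt].
    { exists (fun u => al u k). split; [now apply IH|]. intro v. rewrite Rminus_diag, Rabs_R0. lra. }
    assert (k = S m) by lia; subst k. clear Hk Hgt.
    set (B := Rabs M + 1). assert (HB : 0 < B) by (unfold B; pose proof (Rabs_pos M); lra).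
    set (x := Rmin 1 (eps / B)).
    assert (Hx0 : 0 < x) by (unfold x; apply Rmin_glb_lt; [lra | now apply Rdiv_lt_0_compat]).
    assert (Hx1 : x <= 1) by apply Rmin_l.
    assert (Hx2 : M * x <= eps).
    { apply Rle_trans with (B * (eps / B)); [|right; field; lra].
      apply Rle_trans with (B * x).
      - apply Rmult_le_compat_r; [lra|]. unfold B. pose proof (Rle_abs M). lra.
      - apply Rmult_le_compat_l; [lra | apply Rmin_r]. }
    assert (Hxp : 0 < x ^ S m) by now apply pow_lt.
    exists (fun u => (F u x + poly_sum (al u) m x * -1) * / x ^ S m). split.
    + apply continuous_LR_scal, continuous_LR_plus; [apply HF; lra | apply continuous_LR_scal, continuous_LR_psum, IH].
    + intro v. assert (H := Hrem v (S m) x ltac:(lra)).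
      assert (E : poly_sum (al v) (S m) x = poly_sum (al v) m x + al v (S m) * x ^ S m)
        by (unfold poly_sum; apply tech5).
      rewrite E, (Rabs_pos_eq x) in H by lra.
      apply (Rmult_le_reg_r (x ^ S m)); [exact Hxp|].
      rewrite <- (Rabs_pos_eq (x ^ S m)) at 2 by lra. rewrite <- Rabs_mult.
      replace ((al v (S m) - (F v x + poly_sum (al v) m x * -1) * / x ^ S m) * x ^ S m)
        with (- (F v x - (poly_sum (al v) m x + al v (S m) * x ^ S m))) by (field; lra).
      rewrite Rabs_Ropp. eapply Rle_trans; [exact H|].
      replace (M * x ^ S (S m)) with (M * x * x ^ S m) by (simpl; ring).
      apply Rmult_le_compat_r; lra.
Qed.

(** * Power series and their derivatives *)

(** The factor [k!] turns the falling factorial into a quotient of factorials without division;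
    [k = 0] gives the Taylor coefficients at 0. *)
Lemma iter_PS_derive (a : nat -> R) (n k : nat) :
  Nat.iter n PS_derive a k * INR (fact k) = INR (fact (n + k)) * a (n + k)%nat.
Proof.
  revert k. induction n as [|n IH]; intro k; [simpl; ring|].
  change (Nat.iter (S n) PS_derive a k) with (INR (S k) * Nat.iter n PS_derive a (S k)).
  replace (S n + k)%nat with (n + S k)%nat by lia. rewrite <- IH, fact_simpl, mult_INR. ring.
Qed.

Lemma CV_radius_iter (a : nat -> R) (M : R) (n : nat) (x : R) :
  (forall k, Rabs (a k) <= M) -> -1 < x < 1 ->
  Rbar_lt (Rabs x) (CV_radius (Nat.iter n PS_derive a)).
Proof.
  intros HM Hx.
  assert (E : CV_radius (Nat.iter n PS_derive a) = CV_radius a).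
  { induction n as [|n IH]; [reflexivity|]. simpl. now rewrite CV_radius_derive. }
  rewrite E. apply Rbar_lt_le_trans with (Finite 1).
  - apply Rabs_lt_between. lra.
  - apply (CV_radius_bounded a). exists M. intro k. now rewrite pow1, Rmult_1_r.
Qed.

Lemma PSeries_of_poly_sum (a : nat -> R) (M x l : R) :
  -1 < x < 1 -> (forall m, Rabs (l - poly_sum a m x) <= M * Rabs x ^ S m) -> PSeries a x = l.
Proof.
  intros Hx H. apply is_pseries_unique, is_pseries_R, is_series_Reals.
  assert (Hl : is_lim_seq (fun m => poly_sum a m x) l); [|now apply is_lim_seq_Reals].
  assert (Hx' : Rabs x < 1) by (apply Rabs_lt_between; lra).
  assert (H0 : is_lim_seq (fun m => M * (Rabs x * Rabs x ^ m)) 0).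
  { replace (Finite 0) with (Finite (M * (Rabs x * 0))) by (f_equal; ring).
    do 2 (apply is_lim_seq_mult'; [apply is_lim_seq_const|]).
    apply is_lim_seq_geom. now rewrite Rabs_Rabsolu. }
  apply (is_lim_seq_le_le (fun m => l - M * (Rabs x * Rabs x ^ m)) _
                          (fun m => l + M * (Rabs x * Rabs x ^ m))).
  - intro m. specialize (H m). apply Rabs_le_between in H. simpl in H. lra.
  - replace (Finite l) with (Finite (l - 0)) by (f_equal; ring).
    apply is_lim_seq_minus'; [apply is_lim_seq_const | exact H0].
  - replace (Finite l) with (Finite (l + 0)) by (f_equal; ring).
    apply is_lim_seq_plus'; [apply is_lim_seq_const | exact H0].
Qed.

(** * The expansion of f in powers of x *)

Section Expansion.
Variables (L : LCGroup) (f : R -> L -> Cpx).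
Hypothesis hf : in_P_Sinf L f.

(** The number of signs is [i + 2]: the rescaled cube in dimension [i + 2] lies on [S^(i+1)], and
    the hypothesis on [f] concerns spheres of dimension at least 1. *)
Definition bernstein_coef (i j : nat) (u : L) : Cpx :=
  Csign_coef (S (S i)) j (fun t => f (t / INR (S (S i))) u).

Lemma f_cont_I (u : L) : cont_on_I (fun x => Cre (f x u)) /\ cont_on_I (fun x => Cim (f x u)).
Proof.
  destruct (hf 1%nat (le_n 1)) as [Hc _].
  split; intros x eps Hx Heps; destruct (Hc x u eps Hx Heps) as [d [U [Hd [HU [HUu H]]]]];
    exists d; (split; [exact Hd|]); intros y Hy Hyd;
    (eapply Rle_lt_trans; [apply (Cnorm_ge (Csub (f y u) (f x u))) | now apply H]).
Qed.

Lemma f_contR (x : R) :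
  -1 <= x <= 1 -> continuous_LR L (fun u => Cre (f x u)) /\ continuous_LR L (fun u => Cim (f x u)).
Proof.
  intro Hx. destruct (hf 1%nat (le_n 1)) as [Hc _].
  split; intros u eps Heps; destruct (Hc x u eps Hx Heps) as [d [U [Hd [HU [HUu H]]]]];
    exists U; (split; [exact HU|]); (split; [exact HUu|]); intros v Hv;
    (eapply Rle_lt_trans; [apply (Cnorm_ge (Csub (f x v) (f x u)))|]);
    (apply H; [exact Hx | rewrite Rminus_diag, Rabs_R0; lra | exact Hv]).
Qed.

Lemma bernstein_coef_pos_def (i j : nat) : pos_def_kernel L (fun u v => bernstein_coef i j (gmul (ginv u) v)).
Proof.
  apply (Csign_coef_pos_def L (S (S i)) j (fun t v => f (t / INR (S (S i))) v)).
  apply in_P_S_cube_pos. apply hf. lia.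
Qed.

Lemma bernstein_coef_psum_cvg (u : L) (x : R) :
  -1 <= x <= 1 ->
  is_lim_seq (fun i => poly_sum (fun j => Cre (bernstein_coef i j u)) (S (S i)) x) (Cre (f x u)) /\
  is_lim_seq (fun i => poly_sum (fun j => Cim (bernstein_coef i j u)) (S (S i)) x) (Cim (f x u)).
Proof.
  intro Hx. destruct (f_cont_I u) as [Hr Hi].
  split; (eapply is_lim_seq_ext; [intro; apply bernstein_psum|]).
  - now apply (bernstein_cvg (fun x => Cre (f x u))).
  - now apply (bernstein_cvg (fun x => Cim (f x u))).
Qed.

Lemma bernstein_at_1 (N : nat) : forall g, bernstein N 1 g = g (INR N).
Proof.
  induction N as [|N IH]; intro g; [reflexivity|].
  rewrite S_INR. simpl bernstein. rewrite !IH. field.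
Qed.

(** At [x = 1] every sign is 1, so the Bernstein polynomial takes the exact value [f(1,e)]. This is
    the source of the constant that bounds all coefficient sums. *)
Lemma bernstein_coef_sum_gone (i : nat) :
  sum_f_R0 (fun j => Cre (bernstein_coef i j gone)) (S (S i)) = Cre (f 1 gone).
Proof.
  assert (H := bernstein_psum (S (S i)) 1 (fun t => Cre (f (t / INR (S (S i))) gone))).
  rewrite bernstein_at_1 in H. unfold Rdiv in H at 1. rewrite Rinv_r in H by (apply not_0_INR; lia).
  rewrite H. apply sum_eq. intros j _. rewrite pow1, Rmult_1_r. reflexivity.
Qed.

Lemma bernstein_coef_sum (i : nat) (u : L) :
  sum_f_R0 (fun j => Rabs (Cre (bernstein_coef i j u))) (S (S i)) <= Cre (f 1 gone) /\
  sum_f_R0 (fun j => Rabs (Cim (bernstein_coef i j u))) (S (S i)) <= Cre (f 1 gone).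
Proof.
  rewrite <- (bernstein_coef_sum_gone i). split; apply sum_Rle; intros j _;
    apply (pos_def_bounds L (bernstein_coef i j) u (bernstein_coef_pos_def i j)).
Qed.

Definition phi (j : nat) (u : L) : Cpx :=
  mkC (limcoef (fun i k => Cre (bernstein_coef i k u)) j) (limcoef (fun i k => Cim (bernstein_coef i k u)) j).

Lemma phi_lim (j : nat) (u : L) : is_lim_Cseq (fun i => bernstein_coef i j u) (phi j u).
Proof.
  split.
  - apply (limcoef_correct (fun i k => Cre (bernstein_coef i k u)) (fun x => Cre (f x u)) (Cre (f 1 gone))).
    + intro i. apply (bernstein_coef_sum i u).
    + intros x Hx. apply (bernstein_coef_psum_cvg u x Hx).
  - apply (limcoef_correct (fun i k => Cim (bernstein_coef i k u)) (fun x => Cim (f x u)) (Cre (f 1 gone))).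
    + intro i. apply (bernstein_coef_sum i u).
    + intros x Hx. apply (bernstein_coef_psum_cvg u x Hx).
Qed.

Lemma phi_remainder (m : nat) (u : L) (x : R) :
  -1 <= x <= 1 ->
  Rabs (Cre (f x u) - poly_sum (fun j => Cre (phi j u)) m x) <= Cre (f 1 gone) * Rabs x ^ S m /\
  Rabs (Cim (f x u) - poly_sum (fun j => Cim (phi j u)) m x) <= Cre (f 1 gone) * Rabs x ^ S m.
Proof.
  intro Hx. split.
  - apply (limcoef_remainder (fun i k => Cre (bernstein_coef i k u)) (fun x => Cre (f x u))); [| |exact Hx].
    + intro i. apply (bernstein_coef_sum i u).
    + intros y Hy. apply (bernstein_coef_psum_cvg u y Hy).
  - apply (limcoef_remainder (fun i k => Cim (bernstein_coef i k u)) (fun x => Cim (f x u))); [| |exact Hx].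
    + intro i. apply (bernstein_coef_sum i u).
    + intros y Hy. apply (bernstein_coef_psum_cvg u y Hy).
Qed.

Lemma phi_in_PL (j : nat) : in_PL L (phi j).
Proof.
  split.
  - assert (Hre : continuous_LR L (fun u => Cre (phi j u))).
    { apply (continuous_LR_coefficient L (fun u x => Cre (f x u)) (fun u k => Cre (phi k u)) (Cre (f 1 gone))).
      - intros x Hx. now apply f_contR.
      - intros u m x Hx. now apply phi_remainder. }
    assert (Him : continuous_LR L (fun u => Cim (phi j u))).
    { apply (continuous_LR_coefficient L (fun u x => Cim (f x u)) (fun u k => Cim (phi k u)) (Cre (f 1 gone))).
      - intros x Hx. now apply f_contR.
      - intros u m x Hx. now apply phi_remainder. }
    intros u eps Heps.
    destruct (Hre u (eps / 2) ltac:(lra)) as [U [HU [HUu HUv]]].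
    destruct (Him u (eps / 2) ltac:(lra)) as [V [HV [HVu HVv]]].
    exists (fun x => U x /\ V x). split; [now apply gopen_inter|]. split; [now split|].
    intros v [Hv1 Hv2]. eapply Rle_lt_trans; [apply Cnorm_le|].
    specialize (HUv v Hv1). specialize (HVv v Hv2). cbn [Csub Cre Cim]. lra.
  - apply (pos_def_kernel_lim L (fun i u v => bernstein_coef i j (gmul (ginv u) v))).
    + intro i. apply bernstein_coef_pos_def.
    + intros u v. apply phi_lim.
Qed.

Lemma phi_bounds (j : nat) (u : L) :
  Rabs (Cre (phi j u)) <= Cre (phi j gone) /\ Rabs (Cim (phi j u)) <= Cre (phi j gone) /\
  Cim (phi j gone) = 0.
Proof. apply pos_def_bounds, phi_in_PL. Qed.

Lemma phi_gone_nonneg (j : nat) : 0 <= Cre (phi j gone).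
Proof. eapply Rle_trans; [apply Rabs_pos | apply (phi_bounds j gone)]. Qed.

(** For fixed [m], the partial sum of the approximating coefficients is at most their full sum,
    since those at [e] are nonnegative; then [i] tends to infinity. *)
Lemma phi_gone_sum (m : nat) : sum_f_R0 (fun j => Cre (phi j gone)) m <= Cre (f 1 gone).
Proof.
  assert (H := poly_sum_seq_lim (fun i k => Cre (bernstein_coef i k gone)) (fun k => Cre (phi k gone)) m 1
                 (fun j _ => proj1 (phi_lim j gone))).
  assert (E : forall a, poly_sum a m 1 = sum_f_R0 a m).
  { intro a. apply sum_eq. intros. rewrite pow1. ring. }
  rewrite <- E.
  refine (is_lim_seq_le_loc _ (fun _ => Cre (f 1 gone)) _ _ _ H (is_lim_seq_const _)).
  exists m. intros i Hi. rewrite E, <- (bernstein_coef_sum_gone i).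
  assert (Hm : (m <= S (S i))%nat) by lia. revert Hm. generalize (S (S i)) as N. intros N Hm.
  induction Hm as [|N Hm IH]; [lra|]. rewrite tech5.
  assert (0 <= Cre (bernstein_coef i (S N) gone)); [|lra].
  eapply Rle_trans; [apply Rabs_pos | apply (pos_def_bounds L (bernstein_coef i (S N)) gone (bernstein_coef_pos_def i (S N)))].
Qed.

Lemma phi_gone_cvg : exists l, infinite_sum (fun j => Cre (phi j gone)) l.
Proof.
  destruct (ex_finite_lim_seq_incr (fun m => sum_f_R0 (fun j => Cre (phi j gone)) m)
              (Cre (f 1 gone))) as [l Hl].
  - intro m. rewrite tech5. pose proof (phi_gone_nonneg (S m)). lra.
  - apply phi_gone_sum.
  - exists l. now apply is_lim_seq_Reals in Hl.
Qed.

Lemma phi_sum (m : nat) (u : L) :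
  sum_f_R0 (fun j => Rabs (Cre (phi j u))) m <= Cre (f 1 gone) /\
  sum_f_R0 (fun j => Rabs (Cim (phi j u))) m <= Cre (f 1 gone).
Proof.
  split; (eapply Rle_trans; [|apply (phi_gone_sum m)]); apply sum_Rle; intros; apply phi_bounds.
Qed.

Lemma phi_uniform (eps : R) :
  0 < eps -> exists N, forall m, (N <= m)%nat -> forall x u, -1 <= x <= 1 ->
    Rabs (poly_sum (fun j => Cre (phi j u)) m x - Cre (f x u)) <= eps /\
    Rabs (poly_sum (fun j => Cim (phi j u)) m x - Cim (f x u)) <= eps.
Proof.
  intro Heps. destruct phi_gone_cvg as [l Hl].
  destruct (Hl (eps / 2) ltac:(lra)) as [N HN].
  exists N. intros m Hm x u Hx.
  (* The tail is taken at [e], where it majorises the tail at every [u]; this makes [N] independent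
     of [u]. *)
  assert (Htail : forall n, (m <= n)%nat -> sum_f_R0 (fun j => Cre (phi j gone)) n
                     - sum_f_R0 (fun j => Cre (phi j gone)) m <= eps).
  { intros n Hn. assert (H1 := HN n ltac:(lia)). assert (H2 := HN m ltac:(lia)).
    unfold Rdist in *. apply Rabs_lt_between in H1. apply Rabs_lt_between in H2. lra. }
  destruct (f_cont_I u) as [Hr Hi]. split.
  - apply (poly_sum_uniform (fun x => Cre (f x u)) _ (fun j => Cre (phi j gone)) (Cre (f 1 gone)));
      [exact Hr | intro; apply phi_bounds | intros; now apply phi_remainder | exact Htail | exact Hx].
  - apply (poly_sum_uniform (fun x => Cim (f x u)) _ (fun j => Cre (phi j gone)) (Cre (f 1 gone)));
      [exact Hi | intro; apply phi_bounds | intros; now apply phi_remainder | exact Htail | exact Hx].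
Qed.

(** The right-hand side is free of [u]. The factor 2 adds the estimates of the real and imaginary
    parts. *)
Lemma schoenberg_phi (n d : nat) (u : L) :
  (2 <= d)%nat -> (INR n + 1) * (INR n + 2) <= 2 * INR d ->
  Cnorm (Csub (schoenberg L f d n u) (phi n u)) <= 2 * (schoenberg_error n d * Cre (f 1 gone)).
Proof.
  intros Hd Hnd. eapply Rle_trans; [apply Cnorm_le|].
  destruct (f_cont_I u) as [Hr Hi].
  assert (H1 := schoenberg_component n d (fun x => Cre (f x u)) (fun j => Cre (phi j u))
                  (Cre (f 1 gone)) Hd Hnd Hr (fun m => proj1 (phi_sum m u))).
  assert (H2 := schoenberg_component n d (fun x => Cim (f x u)) (fun j => Cim (phi j u))
                  (Cre (f 1 gone)) Hd Hnd Hi (fun m => proj2 (phi_sum m u))).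
  replace (2 * (schoenberg_error n d * Cre (f 1 gone))) with
    (schoenberg_error n d * Cre (f 1 gone) + schoenberg_error n d * Cre (f 1 gone)) by ring.
  unfold schoenberg, CRInt. cbn [Csub Cscale Cre Cim].
  apply Rplus_le_compat; [apply H1 | apply H2]; intros eps Heps;
    destruct (phi_uniform eps Heps) as [N HN]; exists N; intros m Hm x Hx;
    destruct (HN m Hm x u Hx); assumption.
Qed.

Definition phi_deriv (u : L) (n : nat) (x : R) : Cpx :=
  mkC (PSeries (Nat.iter n PS_derive (fun j => Cre (phi j u))) x)
      (PSeries (Nat.iter n PS_derive (fun j => Cim (phi j u))) x).

Lemma phi_deriv_0 (u : L) (n : nat) : Cscale (/ INR (fact n)) (phi_deriv u n 0) = phi n u.
Proof.
  assert (H := INR_fact_lt_0 n).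
  assert (E : forall a, / INR (fact n) * PSeries (Nat.iter n PS_derive a) 0 = a n).
  { intro a. rewrite PSeries_0. assert (E := iter_PS_derive a n 0).
    rewrite Nat.add_0_r, Rmult_1_r in E. rewrite E. field. lra. }
  apply Cpx_ext; simpl; apply E.
Qed.

Lemma phi_derivs (u : L) : derivs_on_open (fun x => f x u) (phi_deriv u).
Proof.
  split.
  - intros x Hx. apply Cpx_ext; simpl; apply PSeries_of_poly_sum with (Cre (f 1 gone));
      try exact Hx; intro m; apply phi_remainder; lra.
  (* Coefficients bounded by [f(1,e)] give a radius of convergence of at least 1, and termwise
     differentiation preserves the radius. *)
  - assert (B : forall k, Cre (phi k gone) <= Cre (f 1 gone)).
    { intro k. destruct k as [|k]; [apply (phi_gone_sum 0)|].
      eapply Rle_trans; [|apply (phi_gone_sum (S k))]. rewrite tech5.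
      assert (0 <= sum_f_R0 (fun j => Cre (phi j gone)) k); [|lra].
      apply cond_pos_sum. intro. apply phi_gone_nonneg. }
    intros n x Hx. split; apply is_derive_Reals; simpl;
      apply (is_derive_PSeries (Nat.iter n PS_derive _));
      apply (CV_radius_iter _ (Cre (f 1 gone))); try exact Hx;
      intro k; eapply Rle_trans; [apply (phi_bounds k u) | apply B | apply (phi_bounds k u) | apply B].
Qed.

End Expansion.

(** [Csum] stops before its bound and [sum_f_R0] includes it, hence [S m]. *)
Lemma Csum_poly_sum (a : nat -> Cpx) (m : nat) (x : R) (b : nat -> Cpx) :
  (forall k, b k = Cscale (x ^ k) (a k)) ->
  Csum (S m) b = mkC (poly_sum (fun j => Cre (a j)) m x) (poly_sum (fun j => Cim (a j)) m x).
Proof.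
  intro H. unfold poly_sum. induction m as [|m IH].
  - simpl. rewrite H. apply Cpx_ext; simpl; ring.
  - change (Csum (S (S m)) b) with (Cadd (Csum (S m) b) (b (S m))).
    rewrite IH, H, !tech5. apply Cpx_ext; simpl; ring.
Qed.

Theorem theorem1p3 (L : LCGroup) (f : R -> L -> Cpx) (hf : in_P_Sinf L f) :
  exists D : L -> nat -> R -> Cpx,
    (* x |-> f(x,u) is infinitely differentiable on ]-1,1[, D u n its n-th derivative *)
    (forall u, derivs_on_open (fun x => f x u) (D u)) /\
    (* lim_{d -> oo} phi_{n,d}(u) = (1/n!) d^n f(0,u)/dx^n, uniformly on compacts *)
    (forall (n : nat) (K : L -> Prop), compactL L K ->
       forall eps, 0 < eps -> exists d0 : nat, forall d : nat,
         (d0 <= d)%nat -> (2 <= d)%nat -> forall u, K u ->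
           Cnorm (Csub (schoenberg L f d n u) (Cscale (/ INR (fact n)) (D u n 0))) < eps) /\
    (* phi_n in P(L) *)
    (forall n : nat, in_PL L (fun u => Cscale (/ INR (fact n)) (D u n 0))) /\
    (* sum_n phi_n(e_L) < oo *)
    Cseries_converges (fun n => Cscale (/ INR (fact n)) (D gone n 0)) /\
    (* f(x,u) = sum_n phi_n(u) x^n uniformly on [-1,1] x L *)
    (forall eps, 0 < eps -> exists N : nat, forall m : nat, (N <= m)%nat ->
       forall x u, -1 <= x <= 1 ->
         Cnorm (Csub (Csum (S m) (fun k => Cscale (/ INR (fact k) * x ^ k) (D u k 0)))
                     (f x u)) < eps).
Proof.
  exists (phi_deriv L f).
  assert (HM : 0 <= Cre (f 1 gone)).
  { eapply Rle_trans; [|apply (phi_gone_sum L f hf 0)]. apply (phi_gone_nonneg L f hf 0). }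
  assert (E : forall n, (fun u => Cscale (/ INR (fact n)) (phi_deriv L f u n 0)) = phi L f n).
  { intro n. apply FunctionalExtensionality.functional_extensionality. intro u. apply phi_deriv_0. }
  split; [|split; [|split; [|split]]].
  - intro u. now apply phi_derivs.
  - intros n K _ eps Heps.
    (* The added 1 makes [B] positive and the final inequality strict. *)
    set (B := 2 * Cre (f 1 gone) + 1).
    assert (HB : 0 < eps / B) by (unfold B; apply Rdiv_lt_0_compat; lra).
    destruct (proj2 (is_lim_seq_spec _ _) (schoenberg_error_lim n) (mkposreal _ HB)) as [d1 Hd1].
    destruct (nfloor_ex ((INR n + 1) * (INR n + 2))) as [d2 [_ Hd2]].
    { pose proof (pos_INR n). apply Rmult_le_pos; lra. }
    (* [d1] makes [schoenberg_error n d] smaller than [eps / B], and [S d2] exceeds [(n+1)(n+2)], as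
       [schoenberg_phi] requires. *)
    exists (d1 + S d2)%nat. intros d Hd Hd' u _.
    rewrite phi_deriv_0.
    assert (Hd3 : INR d2 + 1 <= INR d) by (rewrite <- S_INR; apply le_INR; lia).
    eapply Rle_lt_trans; [apply schoenberg_phi; [exact hf | exact Hd' |]|].
    + pose proof (pos_INR d). lra.
    + specialize (Hd1 d ltac:(lia)). cbn [pos] in Hd1. rewrite Rminus_0_r in Hd1.
      assert (Hse := Rle_abs (schoenberg_error n d)).
      apply Rle_lt_trans with (eps / B * (2 * Cre (f 1 gone))).
      * replace (2 * (schoenberg_error n d * Cre (f 1 gone))) with (schoenberg_error n d * (2 * Cre (f 1 gone))) by ring.
        apply Rmult_le_compat_r; lra.
      * replace eps with (eps / B * B) at 2 by (field; unfold B; lra).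
        apply Rmult_lt_compat_l; [exact HB | unfold B; lra].
  - intro n. rewrite E. now apply phi_in_PL.
  - destruct (phi_gone_cvg L f hf) as [l Hl]. split.
    + exists l. intros eps Heps. destruct (Hl eps Heps) as [N HN]. exists N. intros n Hn.
      rewrite (sum_eq _ (fun k => Cre (phi L f k gone))) .
      * now apply HN.
      * intros k _. cbv beta. rewrite phi_deriv_0. reflexivity.
    (* The values [phi_n(e)] are real, so every partial sum of imaginary parts is 0. *)
    + exists 0. intros eps Heps. exists 0%nat. intros n _.
      rewrite (sum_eq _ (fun _ => 0)), sum_cte, Rmult_0_l.
      * unfold Rdist. now rewrite Rminus_diag, Rabs_R0.
      * intros k _. rewrite phi_deriv_0. apply (phi_bounds L f hf k gone).
  - intros eps Heps. destruct (phi_uniform L f hf (eps / 4) ltac:(lra)) as [N HN].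
    exists N. intros m Hm x u Hx.
    rewrite (Csum_poly_sum (fun j => phi L f j u) m x).
    + destruct (HN m Hm x u Hx) as [H1 H2].
      eapply Rle_lt_trans; [apply Cnorm_le|]. cbn [Csub Cre Cim]. lra.
    + intro k. rewrite <- (phi_deriv_0 L f u k). apply Cpx_ext; simpl; ring.
Qed.
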